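(* If $z\in \mathrm{FPF}_n(\mathcal{I}_n)$ then $J^{\mathrm{ss}}_z = \mathrm{in}(I^{\mathrm{ss}}_z) = \mathrm{in}(I(X^{\mathrm{ss}}_z))$, where both initial ideals are computed with respect to the reverse lexicographic term order.
   Context: $\mathbb{K}$ is an algebraically closed field, $n$ a positive integer, $[n]=\{1,\dots,n\}$, $\mathbb{N}=\{1,2,3,\dots\}$. $\mathcal{I}_n=\{w\in S_n:w^2=1\}$. For $y\in\mathcal{I}_n$ with fixed points $i_1<\dots<i_k$ in $[n]$, $\mathrm{FPF}_n(y)$ is the fixed-point-free involution of $\mathbb{N}$ given by $y\cdot(i_1,n+1)(i_2,n+2)\cdots(i_k,n+k)\cdot(n+k+1,n+k+2)(n+k+3,n+k+4)\cdots$. $\mathrm{FPF}_n(\mathcal{I}_n)$ is the image of this map. For a permutation $z$ of $\mathbb{N}$, $\mathrm{rank}\,z_{[i][j]}$ is the number of $a\in[i]$ with $z(a)\in[j]$. $\mathrm{Mat}^{\mathrm{ss}}_n$ is the set of $n\times n$ matrices over $\mathbb{K}$ with $A_{ij}=-A_{ji}$, $A_{ii}=0$. Its coordinate ring is identified with $\mathbb{K}[u_{ij}:i,j\in[n],i>j]$, with $u_{ij}$ the function $A\mapsto A_{ij}$. $X^{\mathrm{ss}}_z:=\{A\in\mathrm{Mat}^{\mathrm{ss}}_n:\mathrm{rank}\,A_{[i][j]}\le\mathrm{rank}\,z_{[i][j]}\text{ for all }i,j\in[n]\}$, where $A_{[i][j]}$ is the upper left $i\times j$ submatrix, and $I(X^{\mathrm{ss}}_z)$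 is its vanishing ideal. $\mathcal{U}^{\mathrm{ss}}$ is the $n\times n$ skew-symmetric matrix with $\mathcal{U}^{\mathrm{ss}}_{ij}=u_{ij}=-\mathcal{U}^{\mathrm{ss}}_{ji}$ for $i>j$ and zero diagonal. $I^{\mathrm{ss}}_z$ is the ideal generated by the Pfaffians $\mathrm{pf}(\mathcal{U}^{\mathrm{ss}}_{RR})$ for all nonempty even-sized $R\subseteq[n]$ for which there exist $i,j\in[n]$ with $i\ge j$, $R\subseteq[i]$ and $|R\cap[j]|>\mathrm{rank}\,z_{[i][j]}$. For sets $A=\{a_1<\dots<a_q\}$, $B=\{b_1>\dots>b_q\}$ of positive integers let $A\odot B=\{(a_1,b_1),\dots,(a_q,b_q)\}$. Define $u^{\mathrm{ss}}_{AB}=0$ if some $(a,b)\in A\odot B$ has $a=b$; otherwise $u^{\mathrm{ss}}_{AB}$ is the product of the variables $u_{ij}$ over the set of distinct pairs $(i,j)$ with $i>j$ such that $(i,j)$ or $(j,i)$ is in $A\odot B$. $J^{\mathrm{ss}}_z$ is the ideal of $\mathbb{K}[u_{ij}:i,j\in[n],i>j]$ generated by all $u^{\mathrm{ss}}_{AB}$ where $A\subseteq[i]$, $B\subseteq[j]$, $|A|=|B|=\mathrm{rank}\,z_{[i][j]}+1$ for some $i,j\in[n]$ with $i\ge j$. Reverse lexicographic term order: order variables by $u_{ij}<u_{i'j'}$ if $i<i'$, or $i=i'$ and $j<j'$. Monomials satisfy $M_1<M_2$ if $\deg M_1<\deg M_2$, or if the degrees are equal, the monomials differ, and for the largest variable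 whose exponents $e_1,e_2$ in $M_1,M_2$ differ one has $e_1>e_2$. $\mathrm{in}(f)$ is the maximal monomial with nonzero coefficient in $f$ ($\mathrm{in}(0)=0$), and $\mathrm{in}(I)$ is the $\mathbb{K}$-span of $\{\mathrm{in}(f):f\in I\}$. *)

(* Defs.v *)
From mathcomp Require Import all_boot all_order all_algebra all_fingroup.
From mathcomp Require Import mpoly.

Set Implicit Arguments.
Unset Strict Implicit.
Unset Printing Implicit Defensive.

Import GRing.Theory.
Local Open Scope ring_scope.

(* Indices are 0-based throughout: positive integers are shifted down by one,  *)
(* so that i : 'I_n stands for i + 1 in [n], the set [i + 1] is the set of all *)
(* a <= i, and a permutation of {1, 2, 3, ...} is a function nat -> nat.       *)

(** Fixed-point-free involutions *)

Definition involutions n : {set 'S_n} := [set y | (y ^+ 2 == 1)%g].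

(* [enum] lists 'I_n in increasing order. *)
Definition fixed_points n (y : 'S_n) : seq nat :=
  [seq val i | i <- enum 'I_n & y i == i].

(* With k = #|fixed points|: the j-th fixed point is swapped with n + j, and   *)
(* from n + k on consecutive integers are swapped in pairs.                    *)
Definition FPF n (y : 'S_n) (m : nat) : nat :=
  let s := fixed_points y in
  let k := size s in
  if insub m is Some i then
    if y i == i then (n + index m s)%N else y i
  else if (m < n + k)%N then nth 0%N s (m - n)
  else if odd (m - (n + k)) then m.-1 else m.+1.

Definition rank_perm (z : nat -> nat) (i j : nat) : nat :=
  #|[set a : 'I_i | (z a < j)%N]|.

(** The coordinate ring of skew-symmetric matrices *)

Definition lowpair n := {p : 'I_n * 'I_n | (p.2 < p.1)%N}.

Definition nvars n := #|{: lowpair n}|.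

Notation ssring K n := {mpoly K[nvars n]}.

(* 0 unless i > j *)
Definition uvar (K : closedFieldType) n (i j : 'I_n) : ssring K n :=
  if insub (i, j) is Some p then 'X_(enum_rank (p : lowpair n)) else 0.

Definition Mat_ss (K : closedFieldType) n (A : 'M[K]_n) : Prop :=
  (forall i j, A i j = - A j i) /\ (forall i, A i i = 0).

Definition eval_ss (K : closedFieldType) n (f : ssring K n) (A : 'M[K]_n) : K :=
  f.@[fun v => let p : lowpair n := enum_val v in A (val p).1 (val p).2].

(** Skew-symmetric matrix Schubert varieties *)

Definition ulsub (T : Type) n (A : 'M[T]_n) (i j : 'I_n) : 'M[T]_(i.+1, j.+1) :=
  mxsub (widen_ord (ltn_ord i)) (widen_ord (ltn_ord j)) A.

Definition X_ss (K : closedFieldType) n (z : nat -> nat) (A : 'M[K]_n) : Prop :=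
  Mat_ss A /\
  forall i j : 'I_n, (\rank (ulsub A i j) <= rank_perm z i.+1 j.+1)%N.

Definition vanishing_ideal (K : closedFieldType) n (X : 'M[K]_n -> Prop)
    (f : ssring K n) : Prop :=
  forall A, X A -> eval_ss f A = 0.

(** Ideals and spans *)

Definition ideal_gen (P : comNzRingType) (S : P -> Prop) (f : P) : Prop :=
  exists s : seq (P * P),
    (forall c, c \in s -> S c.2) /\ f = \sum_(c <- s) c.1 * c.2.

Definition lin_span (K : fieldType) (V : lmodType K) (S : V -> Prop) (f : V) :
    Prop :=
  exists s : seq (K * V),
    (forall c, c \in s -> S c.2) /\ f = \sum_(c <- s) c.1 *: c.2.

(** Pfaffians *)

Definition crossings m (w : 'S_m) : nat :=
  #|[set p : 'I_m * 'I_m | [&& p.1 < p.2, p.2 < w p.1 & w p.1 < w p.2]%N]|.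

(* Sum over the perfect matchings of 'I_m, i.e. the fixed-point-free           *)
(* involutions w, signed by the parity of the number of crossing arcs; this    *)
(* avoids denominators and so is valid in every characteristic.                *)
Definition pf (R : comNzRingType) m (A : 'M[R]_m) : R :=
  \sum_(w in involutions m | [forall i, w i != i])
    (-1) ^+ crossings w * \prod_(i < m | (i < w i)%N) A i (w i).

Definition U_ss (K : closedFieldType) n : 'M[ssring K n]_n :=
  \matrix_(i, j)
    if (j < i)%N then uvar K i j else if (i < j)%N then - uvar K j i else 0.

(* [enum_val] enumerates R in increasing order. *)
Definition principal_sub (T : Type) n (A : 'M[T]_n) (R : {set 'I_n}) :
    'M[T]_#|R| :=
  mxsub (@enum_val _ (mem R)) (@enum_val _ (mem R)) A.

Definition I_ss_gen (K : closedFieldType) n (z : nat -> nat) (f : ssring K n) :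
    Prop :=
  exists R : {set 'I_n},
    [/\ R != set0, ~~ odd #|R|,
        exists i j : 'I_n,
          [/\ (j <= i)%N, R \subset [set a : 'I_n | (a <= i)%N]
            & (rank_perm z i.+1 j.+1
                 < #|R :&: [set a : 'I_n | (a <= j)%N]|)%N]
      & f = pf (principal_sub (U_ss K n) R)].

Definition I_ss (K : closedFieldType) n (z : nat -> nat) :
    ssring K n -> Prop :=
  ideal_gen (@I_ss_gen K n z).

(** The monomial ideal *)

Definition odot n (A B : {set 'I_n}) : seq ('I_n * 'I_n) :=
  zip (enum A) (rev (enum B)).

Definition u_ss (K : closedFieldType) n (A B : {set 'I_n}) : ssring K n :=
  if has (fun p => p.1 == p.2) (odot A B) then 0
  else \prod_(p : 'I_n * 'I_n | (p.2 < p.1)%N &&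
          ((p \in odot A B) || ((p.2, p.1) \in odot A B))) uvar K p.1 p.2.

Definition J_ss_gen (K : closedFieldType) n (z : nat -> nat) (f : ssring K n) :
    Prop :=
  exists (i j : 'I_n) (A B : {set 'I_n}),
    [/\ (j <= i)%N,
        A \subset [set a : 'I_n | (a <= i)%N]
          /\ B \subset [set b : 'I_n | (b <= j)%N],
        #|A| = (rank_perm z i.+1 j.+1).+1, #|B| = (rank_perm z i.+1 j.+1).+1
      & f = u_ss K A B].

Definition J_ss (K : closedFieldType) n (z : nat -> nat) :
    ssring K n -> Prop :=
  ideal_gen (@J_ss_gen K n z).

(** Initial ideals for the reverse lexicographic order *)

Definition var_lt n (p q : lowpair n) : bool :=
  ((val p).1 < (val q).1)%N ||
  ((val p).1 == (val q).1) && ((val p).2 < (val q).2)%N.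

Definition revlex_lt n (m1 m2 : 'X_{1..nvars n}) : bool :=
  (mdeg m1 < mdeg m2)%N ||
  (mdeg m1 == mdeg m2) &&
  [exists p : lowpair n,
     (m2 (enum_rank p) < m1 (enum_rank p))%N &&
     [forall q : lowpair n,
        var_lt p q ==> (m1 (enum_rank q) == m2 (enum_rank q))]].

(* [is_init f g] means g = in(f); since the order is total, g is unique. *)
Definition is_init (K : closedFieldType) n (f g : ssring K n) : Prop :=
  (f = 0 /\ g = 0) \/
  exists m : 'X_{1..nvars n},
    [/\ m \in msupp f,
        forall m', m' \in msupp f -> m' != m -> revlex_lt m' m
      & g = 'X_[m]].

Definition init_ideal (K : closedFieldType) n (I : ssring K n -> Prop) :
    ssring K n -> Prop :=
  lin_span (fun g => exists2 f, I f & is_init f g).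

(* Main.v *)
(* One has J <= in(I_ss) <= in(I(X)) <= in(I(O)) <= J, where O is the set of    *)
(* all b Z b^T with b lower triangular and Z the skew-symmetric matrix of z;    *)
(* O is contained in X, and I_ss vanishes on X.                                 *)
(*                                                                              *)
(* J <= in(I_ss): u_AB is divisible by the leading monomial of a Pfaffian in    *)
(* which the block of rows and columns indexed by a part L of A is set to zero. *)
(* Such a Pfaffian lies in the ideal of the ordinary Pfaffians whose index set  *)
(* contains the complementary block, which meets [j] in at least |B| elements.  *)
(*                                                                              *)
(* in(I(O)) <= J, by induction on the rank function of z: a monomial outside J  *)
(* is one whose support D satisfies c_D <= r_z, where c_D(p, q) is the largest  *)
(* size of an antidiagonal chain of D inside [p] x [q]. Take the lowest pair    *)
(* z(i) = j < i with i in [n]. The function c_D is supermodular, with steps at  *)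
(* most 1, symmetric and even on the diagonal; if D avoids (i, j) this forces   *)
(* c_D <= r_z' for some z' = t z t, where t = (i, i'), i < i' and j < z(i').    *)
(* The orbit of z' lies in the closure of the orbit of z and in u_ij = 0. So    *)
(* if g in I(O) has only monomials outside J and g = g0 + u_ij g1 with g0 free  *)
(* of u_ij, then g0 = 0 by induction, and u_ij g1 in I(O) gives g1 in I(O),     *)
(* because O is parametrized by an affine space; induction on the degree        *)
(* yields g = 0.                                                                *)

Require Import Defs.
From mathcomp Require Import all_boot all_order all_algebra all_fingroup.
From mathcomp Require Import mpoly.
From mathcomp Require Import zify ring.

Set Implicit Arguments.
Unset Strict Implicit.
Unset Printing Implicit Defensive.

Import GRing.Theory.

(** * Rank functions of fixed-point-free involutions *)

(** The three ideals form a cycle of inclusions, and all the work lies in its two outer steps. The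
    middle one is [I_ss_vanishes]: if the rank of the upper left i x j block of A is less than the
    size of R meet [j], the rows of [A_RR] with index in that set are dependent and the Pfaffian is
    zero.

    J inside in(I_ss): in reverse lexicographic order a monomial with a large variable is small.
    Hence, when a Pfaffian is expanded along a row whose pivot variable is smaller than every other
    variable of that row but larger than all variables of the remaining leading monomial, leading
    monomials multiply ([lead_pfs_step]). [lead_chain] finds such pivots for every antidiagonal
    chain, at the price of zeroing a block of the matrix; [zpf_in_ideal] brings the modified
    Pfaffians back into the ideal, and [lead_I_ss] and [J_ss_lead] collect the result.

    in(I(X)) inside J: call a monomial good if its support satisfies the rank bounds of z. Bad
    monomials lie in J ([bad_mon_J_ss]), so it is enough that a polynomial vanishing on the orbit of
    z never has a good leading monomial ([lead_bad]). By the first inclusion every bad monomial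
    leads some element of [I_ss], so division ([reduce_mod_leads]) replaces the polynomial by one
    with good monomials only, without touching its good leading coefficient; [zero_of_good] shows
    that this remainder is zero.

    That last step is an induction on the rank function. Its combinatorial half is
    [swap_pair_exists]: a good support that avoids the lowest dot of z is already good for a smaller
    involution z'. It applies to the function [width] because of [width_supermodular] and
    [odd_width]. Its geometric half is that the orbit of z' is a limit of that of z
    ([vanishes_swap_pair]) and that the variable of the lowest dot can be cancelled on the orbit
    ([vanishes_cancel]). *)

Lemma sum_nat_split (V : nmodType) (N : nat) (s : seq nat) (F : nat -> V) :
  uniq s -> all (fun a => a < N) s ->
  (\sum_(0 <= a < N) F a =
   \sum_(a <- s) F a + \sum_(0 <= a < N | a \notin s) F a)%R.
Proof.
move=> us sN; rewrite (bigID (mem s)) /=; congr (_ + _)%R.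
rewrite -big_filter; apply: perm_big; apply: uniq_perm => //.
  by rewrite filter_uniq // iota_uniq.
move=> a; rewrite mem_filter mem_index_iota /=.
by case: (boolP (a \in s)) => //= /(allP sN) ->.
Qed.

Lemma rank_permE z p q : rank_perm z p q = \sum_(0 <= a < p) (z a < q).
Proof.
rewrite /rank_perm big_mkord -sum1_card big_mkcond /=.
by apply: eq_bigr => a _; rewrite inE; case: ltnP.
Qed.

Lemma rank_perm0l z q : rank_perm z 0 q = 0.
Proof. by rewrite rank_permE big_geq. Qed.

Lemma rank_permSl z p q : rank_perm z p.+1 q = rank_perm z p q + (z p < q).
Proof. by rewrite !rank_permE big_nat_recr. Qed.

Lemma leq_rank_perm z p p' q q' :
  p <= p' -> q <= q' -> rank_perm z p q <= rank_perm z p' q'.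
Proof.
move=> lep leq; rewrite !rank_permE (big_cat_nat (leq0n p) lep) /=.
apply: leq_trans (leq_addr _ _); apply: leq_sum => a _.
by case: (ltnP (z a) q) => //= h; rewrite (leq_trans h leq).
Qed.

Section FpfInvolution.

Variable z : nat -> nat.
Hypothesis zK : involutive z.
Hypothesis z_fpf : forall a, z a != a.

Lemma rank_perm_sym p q : rank_perm z p q = rank_perm z q p.
Proof.
have E x y : rank_perm z x y = \sum_(0 <= a < x) \sum_(0 <= b < y) (z a == b).
  rewrite rank_permE; apply: eq_bigr => a _.
  elim: y => [|y IH]; first by rewrite big_geq.
  by rewrite big_nat_recr //= -IH ltnS leq_eqVlt; case: ltngtP.
rewrite !E exchange_big /=; apply: eq_bigr => a _; apply: eq_bigr => b _.
by rewrite -(inj_eq (can_inj zK)) zK eq_sym.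
Qed.

Lemma rank_permSr p q : rank_perm z p q.+1 = rank_perm z p q + (z q < p).
Proof. by rewrite rank_perm_sym rank_permSl rank_perm_sym. Qed.

Lemma odd_rank_perm p : ~~ odd (rank_perm z p p).
Proof.
elim: p => [|p IH]; first by rewrite rank_perm0l.
rewrite rank_permSl rank_permSr ltnS [z p <= p]leq_eqVlt (negbTE (z_fpf p)) /=.
by rewrite -addnA addnn oddD odd_double addbF.
Qed.

Lemma rank_perm_gt0 p q a : a < p -> z a < q -> 0 < rank_perm z p q.
Proof.
move=> lap lzq; have := @leq_rank_perm z a.+1 p q q lap (leqnn _).
by rewrite rank_permSl lzq addn1; apply: leq_trans.
Qed.

(** The mixed difference of the rank function counts the dots (a, z a) in the rectangle [p, p') x
    [q', q), which is assumed to be empty. *)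
Lemma rank_perm_modular p p' q q' : p <= p' -> q' <= q ->
  (forall a, p <= a < p' -> ~~ (q' <= z a < q)) ->
  rank_perm z p q + rank_perm z p' q' = rank_perm z p q' + rank_perm z p' q.
Proof.
move=> lep leq H; rewrite !rank_permE.
rewrite !(big_cat_nat (leq0n p) lep) /=.
suff -> : \sum_(p <= a < p') (z a < q') = \sum_(p <= a < p') (z a < q) by lia.
by apply: eq_big_nat => a /H; lia.
Qed.

Definition transp (i i' a : nat) : nat :=
  if a == i then i' else if a == i' then i else a.

Lemma transpK i i' : involutive (transp i i').
Proof.
by rewrite /transp => a; do !case: eqP => //; congruence.
Qed.

Definition swap_pair (i i' a : nat) : nat := transp i i' (z (transp i i' a)).

Lemma swap_pairK i i' : involutive (swap_pair i i').
Proof. by move=> a; rewrite /swap_pair transpK zK transpK. Qed.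

Lemma swap_pair_fpf i i' a : swap_pair i i' a != a.
Proof. by rewrite /swap_pair (can2_eq (transpK i i') (transpK i i')) z_fpf. Qed.

Lemma swap_pairE i i' : z i < i -> i < i' -> z i < z i' ->
  [/\ uniq [:: i; i'; z i; z i'],
      [/\ swap_pair i i' i = z i', swap_pair i i' i' = z i,
          swap_pair i i' (z i) = i' & swap_pair i i' (z i') = i]
    & forall a, a \notin [:: i; i'; z i; z i'] -> swap_pair i i' a = z a].
Proof.
move=> lzi li lz.
have h1 := z_fpf i'; have h2 : z i' != i.
  by apply/eqP => e; move: lz; rewrite -e zK; lia.
have n1 : i' == i = false by lia.
have n2 : z i == i = false by lia.
have n3 : z i == i' = false by lia.
split.
- by rewrite /= !inE; lia.
- rewrite /swap_pair /transp !eqxx n1 n2 n3 !zK.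
  by rewrite (negbTE h1) (negbTE h2) !zK !eqxx ?n1 ?n2 ?n3.
move=> a; rewrite !inE !negb_or => /and4P[/negbTE e1 /negbTE e2 /eqP e3 /eqP e4].
rewrite /swap_pair {2}/transp e1 e2 /transp.
have -> : z a == i = false by apply/eqP => e; case: e3; rewrite -e zK.
by have -> : z a == i' = false by apply/eqP => e; case: e4; rewrite -e zK.
Qed.

(** The dots (i, z i) and (i', z i') become (i, z i') and (i', z i), and the same happens to their
    mirror images. Each exchange costs one on a rectangle; where the two mirror rectangles overlap
    the rank falls by two. *)
Lemma rank_perm_swap i i' p q : z i < i -> i < i' -> z i < z i' ->
  rank_perm z p q =
  rank_perm (swap_pair i i') p q + ((i < p <= i') && (z i < q <= z i'))
    + ((i < q <= i') && (z i < p <= z i')).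
Proof.
move=> lzi li lz.
(* A range containing all four moved indices, whatever p is, so that their terms can be split
   off. *)
have D w : rank_perm w p q =
    \sum_(0 <= a < p + (i + i' + z i + z i').+1) ((a < p) && (w a < q)).
  rewrite rank_permE [RHS](big_cat_nat (n := p)) //=; last by lia.
  rewrite [X in _ = _ + X]big1_seq ?addn0 => [|a /andP[_]].
    by apply: eq_big_nat => a /andP[_ ->].
  by rewrite mem_index_iota => /andP[h _]; rewrite ltnNge h.
have [u [v1 v2 v3 v4] v5] := swap_pairE lzi li lz.
have a4 : all (fun a => a < p + (i + i' + z i + z i').+1) [:: i; i'; z i; z i'].
  by apply/allP => a; rewrite !inE; lia.
have -> : rank_perm (swap_pair i i') p q =
    ((i < p) && (z i' < q)) + (((i' < p) && (z i < q)) +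
    (((z i < p) && (i' < q)) + ((z i' < p) && (i < q)))) +
    \sum_(0 <= a < p + (i + i' + z i + z i').+1 | a \notin [:: i; i'; z i; z i'])
      ((a < p) && (z a < q)).
  rewrite D (sum_nat_split _ u a4); congr (_ + _); last first.
    by apply: eq_bigr => a /v5 ->.
  by rewrite !big_cons !big_nil v1 v2 v3 v4 addr0.
rewrite D (sum_nat_split _ u a4) !big_cons !big_nil !zK addr0.
have F x x' y y' s t : x < x' -> y < y' ->
    ((x < s) && (y < t)) + ((x' < s) && (y' < t)) =
    ((x < s) && (y' < t)) + ((x' < s) && (y < t))
      + ((x < s <= x') && (y < t <= y')).
  move=> lx ly; rewrite (leqNgt s) (leqNgt t).
  case: (ltnP x s) => g1; case: (ltnP x' s) => g2; lia.
have := F _ _ _ _ p q li lz; have := F _ _ _ _ q p li lz.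
rewrite ![(_ < q) && (_ < p)]andbC.
set S := \sum_(_ <= _ < _ | _) _.
by rewrite /GRing.add /=; do !move: (nat_of_bool _) => ?; lia.
Qed.

(* [c] behaves like the rank function of a skew-symmetric matrix. *)
Lemma swap_pair_exists (c : nat -> nat -> nat) i :
  (forall p q, c p q <= rank_perm z p q) ->
  (forall p q, c p q = c q p) ->
  (forall p, ~~ odd (c p p)) ->
  (forall p q, c p.+1 q <= (c p q).+1) ->
  (forall p p' q q', p <= p' -> q' <= q ->
     c p q + c p' q' <= c p q' + c p' q) ->
  z i < i -> c i.+1 (z i).+1 = 0 ->
  exists i', [/\ i < i', z i < z i' &
    forall p q, c p q <= rank_perm (swap_pair i i') p q].
Proof.
move=> cr csym cev cS csup lzi c0; set j := z i in c0 lzi *.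
have cSr p q : c p q.+1 <= (c p q).+1 by rewrite csym (csym p).
have cadd p q k l : c (p + k) (q + l) <= c p q + k + l.
  elim: l => [|l IH]; last by rewrite addnS; have := cSr (p + k) (q + l); lia.
  elim: k => [|k IH]; first by rewrite !addn0.
  by rewrite addnS; have := cS (p + k) (q + 0); lia.
(* [cover]: no other dot lies in the rectangle spanned by (i, j) and (i', z i'). [sat]: a place of
   this rectangle where [c] equals the rank, hence an obstruction to the swap. *)
pose cover i' := [&& i < i', j < z i' &
  [forall a : 'I_i', ~~ [&& i < a, j < z a & z a < z i']]].
pose sat i' p q := [/\ i < p <= i', j < q <= z i' & c p q = rank_perm z p q].
have coverP i' : cover i' -> [/\ i < i', j < z i' &
    forall a, i < a < i' -> ~~ (j < z a < z i')].
  move=> /and3P[h1 h2 /forallP h3]; split=> // a /andP[ia ai].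
  by have /= := h3 (Ordinal ai); rewrite ia.
have good i' : cover i' -> (forall p q, ~ sat i' p q) ->
    forall p q, c p q <= rank_perm (swap_pair i i') p q.
  move=> /coverP[ii' jz emp] H.
  have zi'i : z i' != i by apply/eqP => e; move: jz; rewrite /j -e zK; lia.
  have d1 p q : i < p <= i' -> j < q <= z i' -> c p q < rank_perm z p q.
    move=> hp hq; have := cr p q; rewrite leq_eqVlt => /orP[/eqP e|//].
    by case: (H p q).
  (* On the overlap of the mirror rectangles a gap of two is needed. On the diagonal both numbers
     are even, so a gap of one is a gap of two; off the diagonal, supermodularity of [c] and
     modularity of the rank compare (p, q), (q, p) with (p, p), (q, q). *)
  have dd p : i < p <= i' -> p <= z i' -> c p p + 1 < rank_perm z p p.
    move=> hp hq; have := d1 p p hp; have := cev p; have := odd_rank_perm p; lia.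
  have d2 p q : i < p <= i' -> p <= z i' -> i < q <= i' -> q <= z i' ->
      c p q + 1 < rank_perm z p q.
    wlog lpq : p q / p <= q.
      move=> W; case: (leqP p q) => h; first exact: W.
      by move=> *; rewrite csym rank_perm_sym; apply: W => //; apply: ltnW.
    move=> hp1 hp2 hq1 hq2; have := csup _ _ _ _ lpq lpq; rewrite (csym q p).
    have M : rank_perm z p q + rank_perm z q p =
             rank_perm z p p + rank_perm z q q.
      apply: rank_perm_modular => // a ha; have := emp a; lia.
    move: M; rewrite (rank_perm_sym q p).
    by have := dd p hp1 hp2; have := dd q hq1 hq2; lia.
  move=> p q; have := rank_perm_swap p q lzi ii' jz; rewrite -/j.
  have := cr p q.
  case: (boolP ((i < p <= i') && (j < q <= z i'))) => [/andP[a1 a2]|_];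
  case: (boolP ((i < q <= i') && (j < p <= z i'))) => [/andP[b1 b2]|_] /=.
  - by have := d2 p q a1; lia.
  - by have := d1 p q a1 a2; lia.
  - by have := d1 q p b1 b2; rewrite csym rank_perm_sym; lia.
  - by lia.
have noconf i' : cover i' ->
    (exists p q, sat i' p q) \/ (forall p q, ~ sat i' p q).
  move=> _; pose b := [exists p : 'I_i'.+1, exists q : 'I_(z i').+1,
    [&& i < p, j < q & c p q == rank_perm z p q]].
  case E : b; rewrite /b in E; [left|right].
    move/existsP: E => [p /existsP[q /and3P[h1 h2 /eqP h3]]].
    by exists p, q; rewrite /sat h1 h2 -ltnS ltn_ord -ltnS ltn_ord.
  move=> p q [/andP[h1 h2] /andP[h3 h4] h5]; apply: (elimF existsP E).
  exists (Ordinal (n := i'.+1) h2); apply/existsP.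
  exists (Ordinal (n := (z i').+1) h4).
  by rewrite /= h1 h3 h5 eqxx.
have dot q : [exists a : 'I_q, (i < z a) && (j < a)] \/
    (forall i', i < i' -> j < z i' -> q <= z i').
  case E: [exists _, _]; [by left|right] => i' h1 h2; rewrite leqNgt.
  apply/negP => h3; apply: (elimF existsP E).
  by exists (Ordinal h3); rewrite /= zK h1 h2.
have first_dot q : [exists a : 'I_q, (i < z a) && (j < a)] ->
    exists i', [/\ i < i', j < z i' < q &
      forall a, i < a < i' -> ~~ (j < z a < q)].
  move=> /existsP[a /andP[h1 h2]].
  have ex : exists i', [&& i < i', j < z i' & z i' < q].
    by exists (z a); rewrite zK h1 h2 /=.
  case: (ex_minnP ex) => i' /and3P[g1 g2 g3] mn; exists i'; split=> //.
    by rewrite g2.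
  move=> b /andP[b1 b2]; apply/negP => /andP[b3 b4].
  by have := mn b; rewrite b1 b3 b4 => /(_ isT); rewrite leqNgt b2.
have r1 : rank_perm z i.+1 j.+1 > 0.
  by apply: (@rank_perm_gt0 _ _ i); rewrite /j.
have [i1 [ii1 ji1 min1]] : exists i1, [/\ i < i1, j < z i1 &
    forall a, i < a < i1 -> z a <= j].
  have ex : exists i', (i < i') && (j < z i').
    pose s := [seq z k | k <- iota 0 j.+1].
    have /allPn[a] : ~~ all (mem s) (iota i.+1 j.+2).
      apply/negP => /allP h.
      have := uniq_leq_size (iota_uniq i.+1 j.+2) h.
      by rewrite size_map !size_iota ltnn.
    rewrite mem_iota => /andP[h1 _] h2; exists a; rewrite h1 ltnNge.
    apply: contra h2 => h2; apply/mapP; exists (z a); rewrite ?zK //.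
    by rewrite mem_iota.
  case: (ex_minnP ex) => i1 /andP[g1 g2] mn; exists i1; split=> // a.
  move=> /andP[b1 b2]; rewrite leqNgt; apply/negP => b3.
  by have := mn a; rewrite b1 b3 => /(_ isT); rewrite leqNgt b2.
have cov1 : cover i1.
  rewrite /cover ii1 ji1; apply/forallP => a; apply/negP => /and3P[h1 h2 _].
  by have := min1 a; rewrite h1 ltn_ord => /(_ isT); rewrite leqNgt h2.
case: (noconf _ cov1) => [[p0 [q0 [hp0 hq0 e0]]]|/(good _ cov1) ?]; last by exists i1.
have {hq0 p0 hp0 e0} : exists p, [/\ i < p <= i1, j < q0 & c p q0 = rank_perm z p q0].
  by exists p0; split=> //; case/andP: hq0.
(* Descent on the column of a saturated place whose row is at most [i1]: either a usable swap
   appears, or a saturated place further left. *)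
elim/ltn_ind: q0 => q IH [p [/andP[ip pi1] jq sp]].
case: (dot q) => [/first_dot[i' [ii' /andP[jz zq] emp]]|nodot]; last first.
  (* Without dots in these columns the rank has slope one along the path from (i+1, j+1) down to row
     p and then right to column q. There [c] starts at zero and the rank at a positive value, so
     [c], growing by at most one per step, cannot catch up. *)
  have rp : forall k, i.+1 + k <= i1 ->
      rank_perm z (i.+1 + k) j.+1 = rank_perm z i.+1 j.+1 + k.
    elim=> [|k IHk] hk; first by rewrite !addn0.
    rewrite addnS rank_permSl IHk; last by lia.
    by rewrite ltnS min1; lia.
  have rq l : j.+1 + l <= q ->
      rank_perm z p (j.+1 + l) = rank_perm z p j.+1 + l.
    elim: l => [|l IHl] hl; first by rewrite !addn0.
    rewrite addnS rank_permSr IHl; last by lia.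
    have := nodot (z (j.+1 + l)); rewrite zK => nd.
    have : z (j.+1 + l) <= i by case: (leqP (z (j.+1 + l)) i) => // h; have := nd h; lia.
    by lia.
  have := cadd i.+1 j.+1 (p - i.+1) (q - j.+1); rewrite c0 !subnKC // sp.
  have := rq (q - j.+1); rewrite subnKC // => /(_ (leqnn _)) ->.
  have := rp (p - i.+1); rewrite subnKC // => /(_ pi1) ->; lia.
have cov : cover i'.
  rewrite /cover ii' jz; apply/forallP => a; apply/negP => /and3P[h1 h2 h3].
  by have := emp a; rewrite h1 ltn_ord h2 (ltn_trans h3 zq) => /(_ isT).
case: (noconf _ cov) => [[p2 [q2 [/andP[ip2 p2i] /andP[jq2 q2z] e2]]]|/(good _ cov) ?];
  last by exists i'.
have q2q : q2 < q by lia.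
case: (leqP p2 i1) => p2i1; first by apply: (IH q2 q2q); exists p2; rewrite ip2.
apply: (IH q2 q2q); exists p; split; rewrite ?ip //.
have pp2 : p <= p2 by lia.
(* Both (p, q) and (p2, q2) are saturated and the rectangle between them has no dot; supermodularity
   of [c] then forces saturation at (p, q2). *)
have M : rank_perm z p q + rank_perm z p2 q2 =
         rank_perm z p q2 + rank_perm z p2 q.
  apply: rank_perm_modular => //; first by lia.
  by move=> a ha; have := emp a; lia.
have := csup _ _ _ _ pp2 (ltnW q2q).
by have := cr p q2; have := cr p2 q; lia.
Qed.

End FpfInvolution.

(** * Antichains of cells *)

Section Antichains.

Variable n : nat.
Implicit Types (x y : 'I_n * 'I_n) (C D : {set 'I_n * 'I_n}).

Definition ple x y := (x.1 <= y.1) && (x.2 <= y.2).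

Definition antichain C := [forall x in C, forall y in C, ple x y ==> (x == y)].

Lemma antichainP C :
  reflect {in C &, forall x y, ple x y -> x = y} (antichain C).
Proof.
apply: (iffP forall_inP) => [H x y Cx Cy xy | H x Cx].
  by move/forall_inP/(_ y Cy)/implyP/(_ xy)/eqP: (H x Cx).
by apply/forall_inP => y Cy; apply/implyP => xy; apply/eqP/H.
Qed.

Lemma ple_trans : transitive ple.
Proof.
move=> y x t /andP[h1 h2] /andP[h3 h4].
by rewrite /ple (leq_trans h1 h3) (leq_trans h2 h4).
Qed.

Lemma ple_anti x y : ple x y -> ple y x -> x = y.
Proof.
case: x y => [a b] [a' b'] /andP[/= h1 h2] /andP[/= h3 h4].
by congr (_, _); apply/val_inj/eqP; rewrite eqn_leq ?h1 ?h2.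
Qed.

Definition box D p q := [set x in D | (x.1 < p) && (x.2 < q)].

Lemma in_box D p q x :
  (x \in box D p q) = [&& x \in D, x.1 < p & x.2 < q].
Proof. by rewrite inE. Qed.

Definition boxE := (in_box, inE).

(** This is the function c_D: antidiagonal chains of cells are the antichains of the componentwise
    order [ple]. *)
Definition width D p q :=
  \max_(C : {set 'I_n * 'I_n} | (C \subset box D p q) && antichain C) #|C|.

Lemma width_geq D C p q :
  C \subset box D p q -> antichain C -> #|C| <= width D p q.
Proof. by move=> h1 h2; apply: leq_bigmax_cond; rewrite h1. Qed.

Lemma antichain0 : antichain set0.
Proof. by apply/antichainP => x y; rewrite boxE. Qed.

Lemma antichainS C C' : C \subset C' -> antichain C' -> antichain C.
Proof.
move=> /subsetP sC /antichainP H; apply/antichainP => x y /sC Cx /sC Cy.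
exact: H.
Qed.

Lemma width_witness D p q :
  exists C, [/\ C \subset box D p q, antichain C & #|C| = width D p q].
Proof.
have [|C /andP[h1 h2] e] := @eq_bigmax_cond _
  (fun C => (C \subset box D p q) && antichain C) (fun C => #|C|).
  by apply/card_gt0P; exists set0; rewrite unfold_in /= sub0set antichain0.
by exists C; split => //; rewrite -e.
Qed.

Lemma width_leq D p q k :
  reflect (forall C, C \subset box D p q -> antichain C -> #|C| <= k)
          (width D p q <= k).
Proof.
apply: (iffP idP) => [h C h1 h2|H].
  exact: leq_trans (width_geq h1 h2) h.
by have [C [h1 h2 <-]] := width_witness D p q; apply: H.
Qed.

(** Two cells of one row are comparable, so an antichain has at most one cell in the added row. *)
Lemma width_step D p q : width D p.+1 q <= (width D p q).+1.
Proof.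
apply/width_leq => C /subsetP CD /antichainP aC.
pose C' := [set x in C | x.1 < p].
have C'w : #|C'| <= width D p q.
  apply: width_geq.
    apply/subsetP => x; rewrite !boxE => /andP[/CD]; rewrite boxE.
    by case/and3P=> -> _ -> ->.
  by apply: antichainS (introT (antichainP C) aC); apply/subsetP => x; rewrite boxE => /andP[].
have : #|C :\: C'| <= 1.
  apply/card_le1_eqP => -[a b] [a' b']; rewrite !boxE => /andP[nx Cx] /andP[ny Cy].
  move: nx ny (CD _ Cx) (CD _ Cy); rewrite Cx Cy !boxE /= -!leqNgt !ltnS.
  move=> px py /and3P[_ xp _] /and3P[_ yp _].
  case: (leqP b' b) => h; first by apply: aC => //; rewrite /ple /=; lia.
  by symmetry; apply: aC => //; rewrite /ple /=; lia.
rewrite cardsD; have -> : C :&: C' = C'.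
  by apply/setIidPr/subsetP => x; rewrite boxE => /andP[].
lia.
Qed.

(** Uncrossing: optimal antichains of the boxes (p, q) and (p', q') are recombined, with the same
    total size, into one antichain of the common box (p, q') and one of (p', q). Inside the common
    box, the cells weakly south-east of a cell of the other antichain join the cells outside that
    box; the rest stays. *)
Lemma width_supermodular D p p' q q' : p <= p' -> q' <= q ->
  width D p q + width D p' q' <= width D p q' + width D p' q.
Proof.
move=> lep lqq.
have [C [/subsetP CD aC <-]] := width_witness D p q.
have [C' [/subsetP CD' aC' <-]] := width_witness D p' q'.
pose B := box D p q'.
pose Cn := C :\: B; pose C's := C' :\: B.
pose C0 := C :&: B; pose C0' := C' :&: B.
(* Y is the south-east envelope of the two chains C0 and C0', X the other one. *)
pose Y := [set x in C0 | [exists y in C0', ple y x]]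
      :|: [set x in C0' | [exists y in C0, ple y x]].
pose X := ((C0 :|: C0') :\: Y) :|: (C0 :&: C0').
move/antichainP: (aC) => HC; move/antichainP: (aC') => HC'.
have B1 x : x \in Cn -> x \in C /\ q' <= x.2.
  rewrite boxE => /andP[nB xC]; split => //; rewrite leqNgt; apply: contra nB.
  by have := CD _ xC; rewrite !boxE => /and3P[-> -> _] ->.
have B2 x : x \in C's -> x \in C' /\ p <= x.1.
  rewrite boxE => /andP[nB xC]; split => //; rewrite leqNgt; apply: contra nB.
  by have := CD' _ xC; rewrite !boxE => /and3P[-> _ ->] ->.
have BB x : x \in B -> x.1 < p /\ x.2 < q' by rewrite boxE => /and3P[].
have YB x : x \in Y -> x \in B.
  by rewrite !boxE => /orP[/andP[/andP[_ ->]]|/andP[/andP[_ ->]]].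
have Yor x : x \in Y -> exists y y', [/\ y \in C0, y' \in C0', ple y x, ple y' x
    & x = y \/ x = y'].
  case/setUP; rewrite boxE => /andP[h1 /exists_inP[y h2 h3]].
    by exists x, y; rewrite h1 h2 h3 /ple !leqnn; split=> //; left.
  by exists y, x; rewrite h1 h2 h3 /ple !leqnn; split=> //; right.
have C0C x : x \in C0 -> x \in C by rewrite boxE => /andP[].
have C0C' x : x \in C0' -> x \in C' by rewrite boxE => /andP[].
have aX : antichain X.
  have key x y : x \in X -> y \in X -> ple x y -> x \in C0 -> y \in C0' -> x = y.
    move=> Xx Xy xy x0 y0; move: Xy; rewrite boxE => /orP[].
      rewrite boxE => /andP[/negP nY _]; case: nY; rewrite boxE; apply/orP; right.
      by rewrite boxE y0; apply/exists_inP; exists x.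
    by rewrite boxE => /andP[/C0C Cy _]; apply: HC => //; apply: C0C.
  have key' x y : x \in X -> y \in X -> ple x y -> x \in C0' -> y \in C0 -> x = y.
    move=> Xx Xy xy x0 y0; move: Xy; rewrite boxE => /orP[].
      rewrite boxE => /andP[/negP nY _]; case: nY; rewrite boxE; apply/orP; left.
      by rewrite boxE y0; apply/exists_inP; exists x.
    by rewrite boxE => /andP[_ /C0C' Cy]; apply: HC' => //; apply: C0C'.
  have Xor x : x \in X -> x \in C0 \/ x \in C0'.
    rewrite boxE => /orP[|/setIP[]]; last by left.
    by rewrite boxE => /andP[_ /setUP].
  apply/antichainP => x y Xx Xy xy.
  case: (Xor x Xx) (Xor y Xy) => [x0|x0] [y0|y0].
  - by apply: HC => //; apply: C0C.
  - exact: key.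
  - exact: key'.
  - by apply: HC' => //; apply: C0C'.
have aY : antichain Y.
  apply/antichainP => x y /Yor[x1 [x2 [a1 a2 a3 a4 xe]]] /Yor[y1 [y2 [b1 b2 b3 b4 ye]]] xy.
  case: ye => ye; subst y.
    have e : x1 = y1 by apply: HC (ple_trans a3 xy); apply: C0C.
    by apply: ple_anti => //; rewrite -e.
  have e : x2 = y2 by apply: HC' (ple_trans a4 xy); apply: C0C'.
  by apply: ple_anti => //; rewrite -e.
have aZ : antichain (Y :|: (Cn :|: C's)).
  have cross x y : x \in Cn -> y \in C's -> ~~ ple x y /\ ~~ ple y x.
    move=> x1 y1; have [xC qx] := B1 x x1; have [yC py] := B2 y y1.
    have := CD _ xC; have := CD' _ yC; rewrite !boxE /ple.
    move=> /and3P[_ h1 h2] /and3P[_ h3 h4].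
    split; rewrite negb_and -!ltnNge; apply/orP; [right|left].
      exact: leq_trans h2 qx.
    exact: leq_trans h3 py.
  have Y1 x y : x \in Cn -> y \in Y -> ~~ ple x y /\ ~~ ple y x.
    move=> x1 yY; have [xC qx] := B1 x x1; have [yp yq] := BB _ (YB _ yY).
    have [y1 [y2 [b1 b2 b3 b4 _]]] := Yor _ yY.
    have n1 : ~~ ple x y.
      by rewrite negb_and -!ltnNge (leq_trans yq qx) orbT.
    split => //; apply/negP => yx.
    have e : y1 = x by apply: HC (ple_trans b3 yx) => //; apply: C0C.
    by move: x1; rewrite -e inE; move: b1; rewrite boxE => /andP[-> ->].
  have Y2 x y : x \in C's -> y \in Y -> ~~ ple x y /\ ~~ ple y x.
    move=> x1 yY; have [xC qx] := B2 x x1; have [yp yq] := BB _ (YB _ yY).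
    have [y1 [y2 [b1 b2 b3 b4 _]]] := Yor _ yY.
    have n1 : ~~ ple x y by rewrite negb_and -!ltnNge (leq_trans yp qx).
    split => //; apply/negP => yx.
    have e : y2 = x by apply: HC' (ple_trans b4 yx) => //; apply: C0C'.
    by move: x1; rewrite -e inE; move: b2; rewrite boxE => /andP[-> ->].
  move/antichainP: aY => HY; apply/antichainP => x y.
  rewrite ![_ \in _ :|: (_ :|: _)]inE ![_ \in Cn :|: _]inE.
  move=> /or3P[hx|hx|hx] /or3P[hy|hy|hy].
  - exact: HY.
  - by have [_ /negP] := Y1 _ _ hy hx.
  - by have [_ /negP] := Y2 _ _ hy hx.
  - by have [/negP] := Y1 _ _ hx hy.
  - by apply: HC; [case: (B1 x hx)|case: (B1 y hy)].
  - by have [/negP] := cross _ _ hx hy.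
  - by have [/negP] := Y2 _ _ hx hy.
  - by have [_ /negP] := cross _ _ hy hx.
  - by apply: HC'; [case: (B2 x hx)|case: (B2 y hy)].
have XB : X \subset B.
  by apply/subsetP => x /setUP[/setDP[/setUP[] /setIP[]]|/setIP[/setIP[]]].
have ZB : Y :|: (Cn :|: C's) \subset box D p' q.
  apply/subsetP => x; rewrite boxE => /orP[/YB|].
    by rewrite !boxE => /and3P[-> h1 h2]; rewrite (leq_trans h1) // (leq_trans h2).
  rewrite boxE => /orP[/B1[/CD]|/B2[/CD']]; rewrite !boxE => /and3P[-> h1 h2] _.
    by rewrite (leq_trans h1 lep).
  by rewrite h1 (leq_trans h2 lqq).
have cX : #|X| + #|Y| = #|C0| + #|C0'|.
  have YU : Y \subset C0 :|: C0'.
    by apply/subsetP => x; rewrite !boxE => /orP[/andP[-> _]|/andP[-> _]]; rewrite ?orbT.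
  have IY : C0 :&: C0' \subset Y.
    apply/subsetP => x /setIP[h1 h2]; rewrite boxE; apply/orP; left; rewrite boxE h1.
    by apply/exists_inP; exists x; rewrite // /ple !leqnn.
  rewrite cardsU.
  have -> : ((C0 :|: C0') :\: Y) :&: (C0 :&: C0') = set0.
    apply/setP => x; rewrite [RHS]inE inE; apply/negP => /andP[/setDP[_ h1] /(subsetP IY)].
    by apply/negP.
  rewrite cards0 subn0 cardsD (setIidPr YU) -(cardsUI C0 C0').
  by rewrite addnAC subnK ?subset_leq_card.
have cZ : #|Y :|: (Cn :|: C's)| = #|Y| + (#|Cn| + #|C's|).
  rewrite !cardsU.
  have -> : Cn :&: C's = set0.
    apply/setP => x; rewrite [RHS]inE inE; apply/negP => /andP[h1 h2].
    have [/CD h3 h4] := B1 _ h1; have [_ h5] := B2 _ h2.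
    by move: h3; rewrite boxE => /and3P[_]; rewrite ltnNge h5.
  have -> : Y :&: (Cn :|: C's) = set0.
    apply/setP => x; rewrite [RHS]inE inE; apply/negP => /andP[/YB h1].
    by case/setUP => /setDP[_]; rewrite h1.
  by rewrite !cards0 !subn0.
have := width_geq XB aX; have := width_geq ZB aZ; rewrite cZ.
rewrite -(cardsID B C) -(cardsID B C') -/C0 -/C0' -/Cn -/C's; lia.
Qed.

Definition above x := x.1 < x.2.
Definition below x := x.2 < x.1.

Definition swap x := (x.2, x.1).

Lemma swapK : involutive swap. Proof. by case. Qed.

Lemma width_sym D : swap @: D = D -> forall p q, width D p q = width D q p.
Proof.
move=> DS.
suff le p q : width D p q <= width D q p by move=> p q; apply/eqP; rewrite eqn_leq !le.
apply/width_leq => C /subsetP CD /antichainP aC.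
rewrite -(card_imset _ (can_inj swapK)); apply: width_geq.
  apply/subsetP => _ /imsetP[x /CD + ->]; rewrite !boxE => /and3P[Dx -> ->].
  by rewrite -DS imset_f.
apply/antichainP => _ _ /imsetP[x Cx ->] /imsetP[y Cy ->].
by rewrite /ple andbC => /(aC _ _ Cx Cy) ->.
Qed.

(** The part of an optimal antichain on one side of the diagonal, together with its mirror image, is
    again an antichain. So neither part exceeds half of the optimum, and both are exactly half. *)
Lemma odd_width D p : swap @: D = D -> {in D, forall x, x.1 != x.2} ->
  ~~ odd (width D p p).
Proof.
move=> DS Dd; have [C [/subsetP CD /antichainP aC eC]] := width_witness D p p.
rewrite -eC.
pose G := [set x in C | above x]; pose H := [set x in C | below x].
have CU : #|C| = #|G| + #|H|.
  rewrite -(cardsID [set x | above x] C); congr (_ + _); apply: eq_card => x.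
    by rewrite !boxE.
  rewrite !boxE andbC /above /below -leqNgt; case: (boolP (x \in C)) => //= /CD.
  by rewrite boxE => /andP[/Dd] h _; rewrite leq_eqVlt eq_sym (negbTE (h : (x.1 : nat) != x.2)).
have main (G' : {set 'I_n * 'I_n}) : G' \subset C ->
    {in G' &, forall x y, ~~ ple x (swap y)} -> 2 * #|G'| <= width D p p.
  move=> /subsetP GC nG.
  have e : #|G' :|: swap @: G'| = 2 * #|G'|.
    rewrite cardsU card_imset; last exact: can_inj swapK.
    suff -> : G' :&: swap @: G' = set0 by rewrite cards0 subn0 mul2n addnn.
    apply/setP => x; rewrite [RHS]inE inE; apply/negP => /andP[h /imsetP[y hy e]].
    by have := nG _ _ h hy; rewrite -e /ple !leqnn.
  rewrite -e; apply: width_geq.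
    apply/subsetP => x; rewrite boxE => /orP[/GC/CD //|/imsetP[y /GC/CD hy ->]].
    by move: hy; rewrite !boxE => /and3P[Dy -> ->]; rewrite -DS imset_f.
  apply/antichainP => x y; rewrite !boxE.
  move=> /orP[hx|/imsetP[x' hx ->]] /orP[hy|/imsetP[y' hy ->]].
  - by apply: aC; apply: GC.
  - by move=> h; have := nG _ _ hx hy; rewrite h.
  - move=> h; have := nG _ _ hx hy; suff -> : ple x' (swap y) by [].
    by move: h; rewrite /ple andbC.
  - rewrite /ple andbC => h; congr swap; apply: aC => //; exact: GC.
have G1 : 2 * #|G| <= width D p p.
  apply: main; first by apply/subsetP => x; rewrite boxE => /andP[].
  move=> x y; rewrite !boxE /above /below => /andP[Cx xl] /andP[Cy yl]; apply/negP.
  rewrite /ple /= => /andP[h1 h2].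
  have : ple x y by rewrite /ple; lia.
  by move/(aC _ _ Cx Cy) => e; move: h2; rewrite e; lia.
have H1 : 2 * #|H| <= width D p p.
  apply: main; first by apply/subsetP => x; rewrite boxE => /andP[].
  move=> x y; rewrite !boxE /above /below => /andP[Cx xl] /andP[Cy yl]; apply/negP.
  rewrite /ple /= => /andP[h1 h2].
  have : ple x y by rewrite /ple; lia.
  by move/(aC _ _ Cx Cy) => e; move: h1; rewrite e; lia.
lia.
Qed.

End Antichains.

(** * The reverse lexicographic order and supports of monomials *)

Local Open Scope ring_scope.

Section Revlex.

Variable n : nat.
Implicit Types (p q : lowpair n) (m : 'X_{1..nvars n}).

Definition vrank p : nat := ((val p).1 * n + (val p).2)%N.

Lemma var_ltE p q : var_lt p q = (vrank p < vrank q)%N.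
Proof.
rewrite /var_lt /vrank; case: p q => [[a b] /= ab] [[a' b'] /= a'b'].
rewrite -val_eqE /=; have := ltn_ord b; have := ltn_ord b'.
case: (ltngtP a a') => [h|h|->] /= h1 h2.
- apply/esym; have : ((a.+1) * n <= a' * n)%N by rewrite leq_mul2r h orbT. rewrite mulSn; lia.
- apply/esym/negbTE; have : ((a'.+1) * n <= a * n)%N by rewrite leq_mul2r h orbT.
  rewrite mulSn; lia.
- by rewrite ltn_add2l.
Qed.

Lemma vrank_inj : injective vrank.
Proof.
move=> p q e; have := var_ltE p q; have := var_ltE q p; rewrite e ltnn /var_lt.
move=> h1 h2; apply/val_inj; case: (val p) (val q) h1 h2 => [a b] [a' b'] /=.
rewrite -!val_eqE /= => h1 h2; congr (_, _); apply/val_inj; rewrite /=; lia.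
Qed.

Lemma revlexP m1 m2 :
  reflect ((mdeg m1 < mdeg m2)%N \/ mdeg m1 = mdeg m2 /\ exists p,
     (m2 (enum_rank p) < m1 (enum_rank p))%N /\
     forall q, (vrank p < vrank q)%N -> m1 (enum_rank q) = m2 (enum_rank q))
   (revlex_lt m1 m2).
Proof.
apply: (iffP orP) => -[h|h]; [by left| |by left|].
  move/andP: h => [/eqP h1 /existsP[p /andP[h2 /forallP h3]]]; right; split=> //.
  by exists p; split=> // q; rewrite -var_ltE => pq; move/implyP/(_ pq)/eqP: (h3 q).
case: h => h1 [p [h2 h3]]; right; rewrite h1 eqxx; apply/existsP; exists p.
by rewrite h2; apply/forallP => q; apply/implyP; rewrite var_ltE => /h3 ->.
Qed.

Lemma revlex_irr m : revlex_lt m m = false.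
Proof.
by apply/negP => /revlexP[|[_ [p []]]]; rewrite ltnn.
Qed.

Lemma revlex_trans : transitive (@revlex_lt n).
Proof.
move=> m2 m1 m3 /revlexP[h|[h [p [h1 h2]]]] /revlexP[h'|[h' [q [h1' h2']]]].
- by apply/revlexP; left; apply: ltn_trans h h'.
- by apply/revlexP; left; rewrite -h'.
- by apply/revlexP; left; rewrite h.
apply/revlexP; right; split; first by rewrite h.
case: (ltngtP (vrank p) (vrank q)) => [pq|qp|/vrank_inj e].
- exists q; rewrite h2 //; split => // r qr; rewrite h2 ?h2' //.
  exact: ltn_trans pq qr.
- exists p; rewrite -h2' //; split => // r pr; rewrite h2 ?h2' //.
  exact: ltn_trans qp pr.
- subst q; exists p; split; first exact: ltn_trans h1' h1.
  by move=> r pr; rewrite h2 ?h2'.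
Qed.

Lemma revlex_total m1 m2 : m1 != m2 -> revlex_lt m1 m2 || revlex_lt m2 m1.
Proof.
move=> ne; case: (ltngtP (mdeg m1) (mdeg m2)) => h.
- by apply/orP; left; apply/revlexP; left.
- by apply/orP; right; apply/revlexP; left.
pose P p := m1 (enum_rank p) != m2 (enum_rank p).
have [p0 Pp0] : exists p, P p.
  apply/existsP; apply: contraNT ne => /existsPn H; apply/eqP/mnmP => i.
  by have := H (enum_val i); rewrite /P enum_valK negbK => /eqP.
case: (@arg_maxnP _ p0 P vrank Pp0) => p Pp mx.
have eqv q : (vrank p < vrank q)%N -> m1 (enum_rank q) = m2 (enum_rank q).
  by move=> pq; apply/eqP; apply: contraTT pq => /mx; rewrite -leqNgt.
case: (ltngtP (m1 (enum_rank p)) (m2 (enum_rank p))) => h'.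
- apply/orP; right; apply/revlexP; right; split=> //; exists p; split=> //.
  by move=> q /eqv.
- by apply/orP; left; apply/revlexP; right; split=> //; exists p; split.
- by move: Pp; rewrite /P h' eqxx.
Qed.

Lemma revlex_add2r m1 m2 m : revlex_lt (m1 + m) (m2 + m) = revlex_lt m1 m2.
Proof.
apply/revlexP/revlexP; rewrite !mdegD ltn_add2r; (case=> [|[h [p [h1 h2]]]]; [by left|right]).
  split; first exact: addIn h.
  exists p; split; first by move: h1; rewrite !mnmDE ltn_add2r.
  by move=> q /h2; rewrite !mnmDE => /addIn.
split; first by rewrite h.
exists p; split; first by rewrite !mnmDE ltn_add2r.
by move=> q /h2; rewrite !mnmDE => ->.
Qed.

Lemma revlex_mdeg m1 m2 : revlex_lt m1 m2 -> (mdeg m1 <= mdeg m2)%N.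
Proof. by case/revlexP => [/ltnW|[->]]. Qed.

(** The feature of the reverse lexicographic order that makes the pivot expansions of Pfaffians
    work. *)
Lemma revlex_largest_var m1 m2 p : mdeg m1 = mdeg m2 ->
  (0 < m1 (enum_rank p))%N ->
  (forall q, (0 < m2 (enum_rank q))%N -> (vrank q < vrank p)%N) ->
  revlex_lt m1 m2.
Proof.
move=> e h1 h2.
case: (@arg_maxnP _ p (fun q => (0 < m1 (enum_rank q))%N) vrank h1) => r rp mx.
have m20 q : (vrank p <= vrank q)%N -> m2 (enum_rank q) = 0%N.
  by move=> pq; apply/eqP; rewrite -leqn0 leqNgt; apply/negP => /h2; rewrite ltnNge pq.
have pr : (vrank p <= vrank r)%N by apply: mx.
apply/revlexP; right; split=> //; exists r; rewrite m20 //; split=> // q rq.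
rewrite m20 ?(leq_trans pr (ltnW rq)) //.
by apply/eqP; rewrite -leqn0 leqNgt; apply/negP => /mx /= h; move: rq; rewrite ltnNge h.
Qed.

Lemma revlex_max (s : seq 'X_{1..nvars n}) (P : pred 'X_{1..nvars n}) :
  has P s -> exists m, [/\ m \in s, P m &
    forall m', m' \in s -> P m' -> m' != m -> revlex_lt m' m].
Proof.
elim: s => //= a s IH.
case: (boolP (has P s)) => [/IH [m [ms Pm mx]] _|/hasPn nP].
  case: (boolP (P a && revlex_lt m a)) => [/andP[Pa ma]|nPa].
    exists a; rewrite mem_head; split=> // m'; rewrite inE => /orP[/eqP->|m's] Pm'.
      by rewrite eqxx.
    case: (eqVneq m' m) => [->//|/(mx _ m's Pm') h _]; exact: revlex_trans h ma.
  exists m; rewrite inE ms orbT; split=> // m'; rewrite inE => /orP[/eqP->|m's] Pm'.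
    by move=> ne; move: nPa (revlex_total ne); rewrite Pm' /= => /negbTE ->; rewrite orbF.
  exact: mx.
rewrite orbF => Pa; exists a; rewrite mem_head; split=> // m'; rewrite inE.
by case/orP => [/eqP->|/nP /negbTE ->]; rewrite ?eqxx.
Qed.

(** Termination measure for the division in [reduce_mod_leads]. *)
Definition nbelow (d : nat) m : nat := #|[set b : bmultinom (nvars n) d | revlex_lt b m]|.

Lemma nbelow_lt d m1 m2 : (mdeg m1 < d)%N -> revlex_lt m1 m2 ->
  (nbelow d m1 < nbelow d m2)%N.
Proof.
move=> dm lt; apply: proper_card; apply/properP; split.
  by apply/subsetP => b; rewrite !inE => h; apply: revlex_trans h lt.
by exists (BMultinom dm); rewrite !inE //= revlex_irr.
Qed.

End Revlex.

(** * Supports of monomials and the rank bounds *)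

Section Support.

Variable n : nat.
Implicit Types (p : lowpair n) (m : 'X_{1..nvars n}).

(** Each variable contributes both mirror cells, since a chain may use it in either orientation. *)
Definition supp m : {set 'I_n * 'I_n} :=
  [set x | [exists p : lowpair n, (0 < m (enum_rank p))%N
     && ((x == val p) || (swap x == val p))]].

Lemma suppP m x : reflect
  (exists2 p, (0 < m (enum_rank p))%N & x = val p \/ swap x = val p)
  (x \in supp m).
Proof.
rewrite inE; apply: (iffP existsP) => [[p /andP[h1 /orP[/eqP h2|/eqP h2]]]|[p h1 h2]].
- by exists p => //; left.
- by exists p => //; right.
by exists p; rewrite h1; case: h2 => ->; rewrite eqxx ?orbT.
Qed.

Lemma supp_sym m : @swap n @: supp m = supp m.
Proof.
have sub : @swap n @: supp m \subset supp m.
  apply/subsetP => _ /imsetP[x /suppP[p h1 h2] ->]; apply/suppP; exists p => //.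
  by rewrite swapK; case: h2; [right|left].
apply/eqP; rewrite eqEsubset sub; apply/subsetP => x sx.
by rewrite -(swapK x) imset_f //; apply: (subsetP sub); rewrite imset_f.
Qed.

Lemma supp_offdiag m : {in supp m, forall x, x.1 != x.2}.
Proof.
move=> x /suppP[p _]; have /= := valP p.
case: x => a b /= h [e|e]; move: h; rewrite -e /= => h; apply/eqP => e'; move: h;
  by rewrite e' ltnn.
Qed.

(* For monomials, this is the complement of the monomial ideal J_z. *)
Definition good (z : nat -> nat) m : bool :=
  [forall p : 'I_n.+1, forall q : 'I_n.+1,
    (width (supp m) p q <= rank_perm z p q)%N].

Lemma width_minn (D : {set 'I_n * 'I_n}) (p q : nat) :
  width D p q = width D (minn p n) (minn q n).
Proof.
rewrite /width; suff -> : box D p q = box D (minn p n) (minn q n) by [].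
by apply/setP => x; rewrite !in_box !leq_min !ltn_ord !andbT.
Qed.

Lemma goodP z m :
  reflect (forall p q : nat, (width (supp m) p q <= rank_perm z p q)%N) (good z m).
Proof.
apply: (iffP forallP) => [H p q|H p]; last by apply/forallP.
have hp : (minn p n < n.+1)%N by rewrite ltnS geq_minr.
have hq : (minn q n < n.+1)%N by rewrite ltnS geq_minr.
rewrite width_minn; have /forallP/(_ (Ordinal hq)) /= := H (Ordinal hp).
by move/leq_trans; apply; apply: leq_rank_perm; apply: geq_minl.
Qed.

Lemma badP z m : ~~ good z m ->
  exists (p q : nat) (C : {set 'I_n * 'I_n}), [/\ (p <= n)%N /\ (q <= n)%N, C \subset box (supp m) p q, antichain C
    & (rank_perm z p q < #|C|)%N].
Proof.
rewrite negb_forall => /existsP[p]; rewrite negb_forall => /existsP[q].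
rewrite -ltnNge => h; have [C [h1 h2 h3]] := width_witness (supp m) p q.
by exists p, q, C; rewrite h1 h2 h3 -ltnS ltn_ord -ltnS ltn_ord.
Qed.

Lemma supp_mono m1 m2 : (m1 <= m2)%MM -> supp m1 \subset supp m2.
Proof.
move=> /mnm_lepP le; apply/subsetP => x /suppP[p h1 h2]; apply/suppP.
by exists p => //; apply: leq_trans (le _).
Qed.

Lemma good_mono z m1 m2 : (m1 <= m2)%MM -> good z m2 -> good z m1.
Proof.
move=> le /goodP H; apply/goodP => p q; apply: leq_trans (H p q).
apply/width_leq => C h1 h2; apply: width_geq h2; apply: subset_trans h1 _.
apply/subsetP => x; rewrite !in_box => /and3P[h3 -> ->].
by rewrite (subsetP (supp_mono le)).
Qed.

(** The two rank conditions leave (i, j) as the only cell of its box that a good support could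
    contain. If it is avoided, the width at (i+1, j+1) is zero, as [swap_pair_exists] requires. *)
Lemma good_swap_pair (z : nat -> nat) (i j : 'I_n) m :
  involutive z -> (forall a, z a != a) -> z i = j :> nat -> (j < i)%N ->
  rank_perm z i j.+1 = 0%N -> rank_perm z i.+1 j = 0%N ->
  (i, j) \notin supp m -> good z m ->
  exists i', [/\ (i < i')%N, (j < z i')%N & good (swap_pair z i i') m].
Proof.
move=> zK zf zij ji r1 r2 nij /goodP g.
have lzi : (z i < i)%N by rewrite zij.
have [|p|p q|p p' q q'|||i' [h1 h2 h3]] :=
  @swap_pair_exists z zK zf (width (supp m)) i g.
- by apply: width_sym; apply: supp_sym.
- by apply: odd_width; [apply: supp_sym | apply: supp_offdiag].
- exact: width_step.
- exact: width_supermodular.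
- by rewrite zij.
- rewrite zij; apply/eqP; rewrite -leqn0; apply/width_leq => C /subsetP CD _.
  rewrite leqn0 cards_eq0; apply/eqP/setP => x; rewrite [RHS]inE.
  apply/negP => Cx; move: (CD _ Cx); rewrite in_box !ltnS => /and3P[sx xi xj].
  have one a b : (x.1 < a)%N -> (x.2 < b)%N -> rank_perm z a b <> 0%N.
    move=> xa xb e; have := g a b; rewrite e leqNgt => /negP; apply.
    apply: leq_trans (width_geq (C := [set x]) _ _); first by rewrite cards1.
      by rewrite sub1set in_box sx xa xb.
    by apply/antichainP => y y' /set1P -> /set1P ->.
  case: (eqVneq (x.1 : nat) i) => e1; last first.
    by apply: (one i j.+1) => //; rewrite ltn_neqAle e1.
  case: (eqVneq (x.2 : nat) j) => e2; last first.
    by apply: (one i.+1 j) => //; rewrite ltn_neqAle e2.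
  move/negP: nij; apply; suff <- : x = (i, j) by [].
  by case: (x) e1 e2 => a b /= /val_inj -> /val_inj ->.
exists i'; rewrite -zij; split=> //.
by apply/goodP.
Qed.

End Support.

(** * Pfaffians by iterated contraction *)

Section Contraction.

Variables (R : comNzRingType) (T : eqType).
Implicit Types (h : T -> R) (phi : seq T -> R) (s w : seq T).

(* The alternating sum of [h y * phi (s without y)] over the entries [y] of    *)
(* [s]: contraction with [h] in the exterior algebra.                          *)
Fixpoint ctr h phi s : R :=
  if s is y :: s' then h y * phi s' - ctr h (fun w => phi (y :: w)) s' else 0.

Lemma eq_ctr h h' phi phi' s : {in s, h =1 h'} ->
  (forall w, size w = (size s).-1 -> phi w = phi' w) ->
  ctr h phi s = ctr h' phi' s.
Proof.
elim: s phi phi' => //= y s IH phi phi' eh ep.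
rewrite eh ?mem_head // ep //; congr (_ - _).
case: s IH eh ep => [//|y' s] IH eh ep; apply: IH => [x xs|w /= sw].
  by apply: eh; rewrite inE xs orbT.
by apply: ep; rewrite /= sw.
Qed.

Lemma ctr0r h s : ctr h (fun=> 0) s = 0.
Proof. by elim: s => //= y s ->; rewrite mulr0 subrr. Qed.

Lemma ctr0l phi s : ctr (fun=> 0) phi s = 0.
Proof. by elim: s phi => //= y s IH phi; rewrite IH mul0r subrr. Qed.

Lemma ctrDr h phi1 phi2 s :
  ctr h (fun w => phi1 w + phi2 w) s = ctr h phi1 s + ctr h phi2 s.
Proof.
elim: s phi1 phi2 => [|y s IH] phi1 phi2 /=; first by rewrite addr0.
by rewrite IH mulrDr opprD addrACA.
Qed.

Lemma ctrZr c h phi s : ctr h (fun w => c * phi w) s = c * ctr h phi s.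
Proof.
elim: s phi => [|y s IH] phi /=; first by rewrite mulr0.
by rewrite IH mulrBr mulrCA.
Qed.

Lemma ctrNr h phi s : ctr h (fun w => - phi w) s = - ctr h phi s.
Proof.
elim: s phi => [|y s IH] phi /=; first by rewrite oppr0.
by rewrite IH mulrN opprD.
Qed.

Lemma ctrBr h phi1 phi2 s :
  ctr h (fun w => phi1 w - phi2 w) s = ctr h phi1 s - ctr h phi2 s.
Proof. by rewrite ctrDr ctrNr. Qed.

Lemma ctrDl h1 h2 phi s :
  ctr (fun y => h1 y + h2 y) phi s = ctr h1 phi s + ctr h2 phi s.
Proof.
elim: s phi => [|y s IH] phi /=; first by rewrite addr0.
by rewrite IH mulrDl opprD addrACA.
Qed.

Lemma ctrZl c h phi s : ctr (fun y => c * h y) phi s = c * ctr h phi s.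
Proof.
elim: s phi => [|y s IH] phi /=; first by rewrite mulr0.
by rewrite IH mulrBr mulrA.
Qed.

Lemma ctr_suml (I : Type) (l : seq I) (h : I -> T -> R) phi s :
  ctr (fun y => \sum_(x <- l) h x y) phi s = \sum_(x <- l) ctr (h x) phi s.
Proof.
elim: l => [|x l IH].
  rewrite big_nil (eq_ctr (h' := fun=> 0) (phi' := phi)) ?ctr0l // => y _.
  by rewrite big_nil.
rewrite big_cons -IH -ctrDl; apply: eq_ctr => // y _.
by rewrite big_cons.
Qed.

Lemma ctr_anticomm h1 h2 phi s :
  ctr h1 (ctr h2 phi) s = - ctr h2 (ctr h1 phi) s.
Proof.
elim: s phi => [|y s IH] phi /=; first by rewrite oppr0.
by rewrite !ctrBr !ctrZr IH; ring.
Qed.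

(** In characteristic 2 this does not follow from anticommutation. *)
Lemma ctr_sq h phi s : ctr h (ctr h phi) s = 0.
Proof.
elim: s phi => [|y s IH] phi //=.
by rewrite ctrBr ctrZr IH subr0 subrr.
Qed.

Definition alternating phi :=
  (forall s1 x y s2, phi (s1 ++ x :: y :: s2) = - phi (s1 ++ y :: x :: s2)) /\
  (forall s1 x s2, phi (s1 ++ x :: x :: s2) = 0).

Lemma alternating_cons phi x : alternating phi -> alternating (fun w => phi (x :: w)).
Proof.
case=> A1 A2; split=> [s1 y z s2|s1 y s2]; first exact: (A1 (x :: s1)).
exact: (A2 (x :: s1)).
Qed.

Lemma alternating_ctr h phi : alternating phi -> alternating (ctr h phi).
Proof.
move=> A; split=> [s1|s1].
  elim: s1 phi A => [|z s1 IH] phi A x y s2 /=.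
    have [A1 _] := A; have e w : phi [:: x, y & w] = - phi [:: y, x & w].
      exact: (A1 [::]).
    rewrite (eq_ctr (h' := h) (phi' := fun w => - phi [:: y, x & w])) // ctrNr.
    by ring.
  have [A1 _] := A; rewrite A1 (IH _ (alternating_cons z A)).
  by rewrite opprB mulrN opprK addrC.
elim: s1 phi A => [|z s1 IH] phi A x s2 /=.
  have [_ A2] := A.
  rewrite (eq_ctr (h' := h) (phi' := fun=> 0) (phi := fun w => phi [:: x, x & w])) //.
    by rewrite ctr0r subr0 subrr.
  by move=> w _; apply: (A2 [::]).
have [_ A2] := A; by rewrite A2 (IH _ (alternating_cons z A)) mulr0 subrr.
Qed.

Lemma alternating_move phi s1 x s2 : alternating phi ->
  phi (s1 ++ x :: s2) = (-1) ^+ size s1 * phi (x :: s1 ++ s2).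
Proof.
elim: s1 phi => [|y s1 IH] phi A /=; first by rewrite mul1r.
rewrite (IH _ (alternating_cons y A)); have [A1 _] := A.
by rewrite (A1 [::]) exprS mulrN mulN1r mulNr.
Qed.

Lemma alternating_perm phi s t : alternating phi -> perm_eq s t ->
  exists b : bool, phi s = (-1) ^+ b * phi t.
Proof.
elim: s phi t => [|x s IH] phi t A pst.
  by move: pst; rewrite perm_sym => /perm_nilP ->; exists false; rewrite mul1r.
have xt : x \in t by rewrite -(perm_mem pst) mem_head.
case: (path.splitPr xt) pst => t1 t2.
rewrite -cat1s perm_sym -cat1s perm_catCA perm_cat2l perm_sym => pst.
have [b e] := IH _ _ (alternating_cons x A) pst.
exists (b (+) odd (size t1)); rewrite e (alternating_move t1 x t2 A).
rewrite -[(-1) ^+ size t1]signr_odd signr_addb mulrA; congr (_ * _).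
by rewrite -mulrA -signr_addb addbb mulr1.
Qed.

Lemma alternating_nuniq phi s : alternating phi -> ~~ uniq s -> phi s = 0.
Proof.
elim: s phi => //= x s IH phi A; rewrite negb_and negbK => /orP[xs|]; last first.
  exact: (IH _ (alternating_cons x A)).
case: (path.splitPr xs) => s1 s2.
rewrite (alternating_move s1 x s2 (alternating_cons x A)).
by case: A => _ A2; rewrite (A2 [::]) mulr0.
Qed.

End Contraction.

(** * Pfaffians indexed by lists, by first-row expansion *)

Section ListPfaffian.

Variables (R : comNzRingType) (T : eqType) (a : T -> T -> R).

(** The number [k] is fuel: [ctr] calls its argument on lists that are not structural subterms. By
    [pfn_pfs] any fuel at least the length gives the same value. *)
Fixpoint pfn (k : nat) (s : seq T) : R :=
  match s, k with
  | [::], _ => 1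
  | x :: s', k'.+1 => ctr (a x) (pfn k') s'
  | _, _ => 0
  end.

Definition pfs (s : seq T) : R := pfn (size s) s.

Lemma pfn_pfs k s : (size s <= k)%N -> pfn k s = pfs s.
Proof.
suff H l : (size s <= k)%N -> (size s <= l)%N -> pfn k s = pfn l s by move/H; apply.
elim: k l s => [|k IH] [|l] [|x s] //=; rewrite !ltnS => sk sl.
apply: eq_ctr => // w sw.
by apply: IH; rewrite sw (leq_trans (leq_pred _)).
Qed.

Lemma pfs_nil : pfs [::] = 1. Proof. by []. Qed.

Lemma pfs_cons x s : pfs (x :: s) = ctr (a x) pfs s.
Proof.
rewrite {1}/pfs /=; apply: eq_ctr => // w sw.
by apply: pfn_pfs; rewrite sw leq_pred.
Qed.

Lemma pfs_odd s : odd (size s) -> pfs s = 0.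
Proof.
have [k] := ubnP (size s); elim: k s => // k IH [|x [|y s]] //=.
rewrite !ltnS negbK => sk os; rewrite pfs_cons.
rewrite (eq_ctr (h' := a x) (phi' := fun=> 0)) ?ctr0r // => w /= sw.
by apply: IH; rewrite sw // ltnW.
Qed.

Hypothesis a_skew : forall x y, a x y = - a y x.
Hypothesis a_diag : forall x, a x x = 0.

(** Expansion along the first two entries x, y gives [a x y] times a Pfaffian minus a double
    contraction; the first changes sign by skewness, the second because contractions anticommute.
    Later positions follow from [alternating_ctr]. *)
Lemma pfs_alternating : alternating pfs.
Proof.
suff A k : alternating (pfn k).
  split=> [s1 x y s2|s1 x s2]; rewrite /pfs !size_cat /=.
    by have [A1 _] := A (size s1 + (size s2).+2)%N; apply: A1.
  by have [_ A2] := A (size s1 + (size s2).+2)%N; apply: A2.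
elim: k => [|k IH].
  by split=> [[|z s1] x y s2|[|z s1] x s2] //=; rewrite oppr0.
split=> [[|z s1] x y s2|[|z s1] x s2] /=.
- case: k IH => [|k] IH /=.
    by rewrite !ctr0r !subr0 a_skew mulNr.
  by rewrite ctr_anticomm a_skew mulNr opprK opprB addrC.
- by have [A1 _] := alternating_ctr (a z) IH; apply: A1.
- case: k IH => [|k] IH /=; first by rewrite ctr0r a_diag mul0r subrr.
  by rewrite ctr_sq a_diag mul0r subrr.
- by have [_ A2] := alternating_ctr (a z) IH; apply: A2.
Qed.

Lemma pfs_perm s t : perm_eq s t -> exists b : bool, pfs s = (-1) ^+ b * pfs t.
Proof. exact: alternating_perm pfs_alternating. Qed.

Lemma pfs_nuniq s : ~~ uniq s -> pfs s = 0.
Proof. exact: alternating_nuniq pfs_alternating. Qed.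

(** As in Cramer's rule: the kernel relation turns [c x0] times the Pfaffian into a combination of
    Pfaffians with a repeated index. *)
Lemma pfs_lker s (c : T -> R) x0 : x0 \in s -> uniq s -> GRing.lreg (c x0) ->
  {in s, forall y, \sum_(x <- s) c x * a x y = 0} -> pfs s = 0.
Proof.
move=> x0s us reg ker; have [b ->] := pfs_perm (perm_to_rem x0s).
suff -> : pfs (x0 :: rem x0 s) = 0 by rewrite mulr0.
apply: reg; rewrite mulr0 pfs_cons -ctrZl.
rewrite (eq_ctr (h' := fun y => \sum_(x <- rem x0 s) (- c x) * a x y) (phi' := pfs)) //.
  rewrite ctr_suml big_seq big1 // => x xs; rewrite ctrZl -pfs_cons pfs_nuniq ?mulr0 //=.
  by rewrite xs.
move=> y ys; have := ker y (mem_rem ys).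
rewrite (perm_big _ (perm_to_rem x0s)) big_cons /= => /eqP.
rewrite addr_eq0 => /eqP ->; rewrite -sumrN; apply: eq_bigr => x _.
by rewrite mulNr.
Qed.

End ListPfaffian.

Lemma eq_pfs (R : comNzRingType) (T : eqType) (a a' : T -> T -> R) s :
  {in s &, forall x y, a x y = a' x y} -> pfs a s = pfs a' s.
Proof.
have [k] := ubnP (size s); elim: k s => // k IH [|x s] //=.
rewrite ltnS => sk e; rewrite !pfs_cons.
suff W (phi phi' : seq T -> R) (w : seq T) : {subset w <= s} ->
    (forall u, (size u < size w)%N -> {subset u <= w} -> phi u = phi' u) ->
    ctr (a x) phi w = ctr (a' x) phi' w.
  apply: W => // u su us; apply: IH; first exact: ltn_trans su sk.
  by move=> y z yu zu; apply: e; rewrite inE us // orbT.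
elim: w phi phi' => //= y w IHw phi phi' ws E; congr (_ * _ - _).
- by apply: e; rewrite !inE ?eqxx // ws ?mem_head ?orbT.
- by apply: E => // u uw; rewrite inE uw orbT.
apply: IHw => [u uw|u su us]; first by apply: ws; rewrite inE uw orbT.
apply: E => // v; rewrite !inE => /orP[->//|/us ->].
by rewrite orbT.
Qed.

Lemma pfs_map (R : comNzRingType) (T T' : eqType) (a : T' -> T' -> R)
  (f : T -> T') s : pfs a (map f s) = pfs (fun x y => a (f x) (f y)) s.
Proof.
have [k] := ubnP (size s); elim: k s => // k IH [|x s] //=.
rewrite ltnS => sk; rewrite !pfs_cons.
suff W (phi : seq T' -> R) (phi' : seq T -> R) (w : seq T) :
    (forall u, (size u < size w)%N -> phi (map f u) = phi' u) ->
    ctr (a (f x)) phi (map f w) = ctr (fun y => a (f x) (f y)) phi' w.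
  by apply: W => u su; apply: IH; apply: ltn_trans su sk.
elim: w phi phi' => //= y w IHw phi phi' E; congr (_ * _ - _).
  exact: E.
by apply: IHw => u su; rewrite -[f y :: _]/(map f (y :: u)) E.
Qed.

Lemma rmorph_pfs (R R' : comNzRingType) (T : eqType) (a : T -> T -> R)
  (f : {rmorphism R -> R'}) s : f (pfs a s) = pfs (fun x y => f (a x y)) s.
Proof.
have [k] := ubnP (size s); elim: k s => [//|k IH] [|x s] /=.
  by rewrite !pfs_nil rmorph1.
rewrite ltnS => sk; rewrite !pfs_cons.
suff W (phi : seq T -> R) (phi' : seq T -> R') (w : seq T) :
    (forall u, (size u < size w)%N -> f (phi u) = phi' u) ->
    f (ctr (a x) phi w) = ctr (fun y => f (a x y)) phi' w.
  by apply: W => u su; apply: IH; apply: ltn_trans su sk.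
elim: w phi phi' => /= [|y w IHw] phi phi' E; first by rewrite rmorph0.
rewrite rmorphB rmorphM E // (IHw _ (fun u => phi' (y :: u))) //.
by move=> u su; apply: E.
Qed.

(** * Pfaffians with a zeroed diagonal block *)

Section ZeroBlock.

Variables (R : comNzRingType) (T : eqType) (a : T -> T -> R).
Hypothesis a_skew : forall x y, a x y = - a y x.
Hypothesis a_diag : forall x, a x x = 0.

Definition zero_block (x y : bool * T) : R :=
  if x.1 && y.1 then 0 else a x.2 y.2.

Lemma zero_block_skew x y : zero_block x y = - zero_block y x.
Proof. by rewrite /zero_block andbC; case: ifP; rewrite ?oppr0. Qed.

Lemma zero_block_diag x : zero_block x x = 0.
Proof. by rewrite /zero_block a_diag if_same. Qed.

Definition tagl (x : T) := (true, x).
Definition tagr (x : T) := (false, x).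
Definition zpf (L S : seq T) : R := pfs zero_block (map tagl L ++ map tagr S).

Variable I : R -> Prop.
Hypothesis I0 : I 0.
Hypothesis IB : forall x y, I x -> I y -> I (x - y).
Hypothesis IM : forall x y, I y -> I (x * y).

Lemma ctr_in_ideal (U : eqType) (h : U -> R) phi s1 s2 :
  {in s2, forall y, h y = 0} ->
  (forall w, (size w < size s1)%N -> {subset w <= s1} -> I (phi (w ++ s2))) ->
  I (ctr h phi (s1 ++ s2)).
Proof.
move=> h0; elim: s1 phi => [|y s1 IH] phi Iphi /=.
  have -> : ctr h phi s2 = 0 by rewrite (eq_ctr (h' := fun=> 0) (phi' := phi)) ?ctr0l.
  exact: I0.
apply: IB; first by apply: IM; apply: Iphi => // x xs; rewrite inE xs orbT.
apply: IH => w sw ws; apply: (Iphi (y :: w)) => // x.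
by rewrite !inE => /orP[->|/ws ->] //; rewrite orbT.
Qed.

(* Clearing the row of [x] in the zeroed block one entry at a time turns [x]   *)
(* into an element of the other block.                                         *)
Lemma zpf_in_ideal L S :
  (forall W, {subset S <= W} -> {subset W <= L ++ S} -> I (pfs a W)) ->
  I (zpf L S).
Proof.
have [k] := ubnP (size L); elim: k L S => // k IH [|x L] S /=.
  rewrite /zpf /= pfs_map => _ H; apply: H => //.
rewrite ltnS => sk H; rewrite /zpf /= pfs_cons.
(* The row of [tagl x] is the row of [tagr x] minus its part [hl] on the zeroed block. The first
   contributes, up to sign, [zpf L (x :: S)]; the second only removes elements of [L], so both are
   smaller cases. *)
pose h1 := zero_block (tagr x); pose hl y := if y.1 then h1 y else 0.
rewrite (eq_ctr (h' := fun y => h1 y + (-1) * hl y) (phi' := pfs zero_block)) //; last first.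
  move=> [[] y] _; rewrite /zero_block /hl /h1 /zero_block /=.
    by rewrite mulN1r subrr.
  by rewrite mulr0 addr0.
rewrite ctrDl ctrZl mulN1r; apply: IB.
  rewrite -pfs_cons.
  have [b ->] : exists b : bool, pfs zero_block (tagr x :: map tagl L ++ map tagr S)
     = (-1) ^+ b * zpf L (x :: S).
    apply: pfs_perm; [exact: zero_block_skew | exact: zero_block_diag |].
    by rewrite /= perm_sym -(cat1s (tagr x) (map tagr S)) perm_catCA.
  apply: IM; apply: IH => // W sW Ws; apply: H => [y yS|y /Ws].
    by apply: sW; rewrite inE yS orbT.
  by rewrite !(mem_cat, inE); case/or3P => ->; rewrite ?orbT.
apply: ctr_in_ideal => [[b y] /mapP[y' _ [-> ->]] //|w sw ws].
have -> : w = map tagl (map snd w).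
  rewrite -map_comp -[LHS]map_id; apply/eq_in_map => y /ws /mapP[y' _ ->] //.
apply: IH; first by rewrite size_map; move: sw; rewrite size_map => /ltn_trans; apply.
move=> W sW Ws; apply: H => // y /Ws; rewrite !(mem_cat, inE) => /orP[/mapP[y' /ws]|->].
  by case/mapP=> y2 yL -> -> /=; rewrite yL !orbT.
by rewrite !orbT.
Qed.

End ZeroBlock.

(** * The Pfaffian as a signed sum over matchings *)

Lemma ctr_sum (R : comNzRingType) (T : eqType) (h : T -> R) phi (s : seq T) :
  uniq s ->
  ctr h phi s = \sum_(y <- s) (-1) ^+ index y s * (h y * phi (rem y s)).
Proof.
elim: s phi => [|x s IH] phi /=; first by rewrite big_nil.
case/andP=> xs us; rewrite big_cons !eqxx mul1r IH // -sumrN; congr (_ + _).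
rewrite !big_seq; apply: eq_bigr => y ys.
have -> : x == y = false by apply/negbTE; apply: contraNneq xs => ->.
by rewrite exprS mulN1r mulNr.
Qed.

Lemma index_sorted (m : nat) (s : seq 'I_m) y :
  sorted ltn [seq val i | i <- s] -> y \in s ->
  index y s = count (fun e : 'I_m => (e < y)%N) s.
Proof.
elim: s => //= x s IH xs; have ss := path_sorted xs.
have xmin : {in s, forall e : 'I_m, (x < e)%N}.
  move=> e es; move: xs; rewrite (path_sortedE ltn_trans) => /andP[/allP H _].
  by apply: H; rewrite map_f.
rewrite inE; case: eqVneq => [->|ne] /= ys.
  rewrite ltnn add0n; apply/esym/eqP; rewrite -leqn0 leqNgt -has_count.
  by apply/hasPn => e /xmin; rewrite -leqNgt => /ltnW.
by rewrite xmin // IH.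
Qed.

Section PfaffianAsSum.

Variables (m : nat).
Implicit Types (S : {set 'I_m}) (w u : 'S_m) (x y e : 'I_m).

(** Matchings of [S] are permutations of the whole of ['I_m], fixing the complement, so that an arc
    can be removed by a transposition without changing the type. *)
Definition matchings S : {set 'S_m} :=
  [set w : 'S_m | [forall i, w (w i) == i] && [forall i, (w i != i) == (i \in S)]].

Lemma matchingsP S w :
  reflect ((forall i, w (w i) = i) /\ (forall i, (w i != i) = (i \in S)))
          (w \in matchings S).
Proof.
rewrite inE; apply: (iffP andP) => -[h1 h2].
  split=> i; first by apply/eqP; apply: (forallP h1).
  by have /eqP := forallP h2 i.
by split; apply/forallP => i; rewrite ?h1 ?h2.
Qed.

Lemma tpermN x y i : i != x -> i != y -> tperm x y i = i.
Proof. by move=> h1 h2; rewrite tpermD // eq_sym. Qed.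

Lemma matchings_step S x y w : x \in S -> y \in S -> x != y ->
  ((w * tperm x y)%g \in matchings S) && ((w * tperm x y)%g x == y)
  = (w \in matchings (S :\ x :\ y)).
Proof.
move=> xS yS xy; have yx : y != x by rewrite eq_sym.
apply/idP/idP.
  case/andP=> /matchingsP[inv sup] /eqP; rewrite permM => /(congr1 (tperm x y)).
  rewrite tpermK tpermR => wx.
  have wy : w y = y.
    by have := inv x; rewrite !permM wx tpermL => /(congr1 (tperm x y));
       rewrite tpermK tpermL.
  have wD i : i != x -> i != y -> (w i != x) && (w i != y).
    move=> ix iy; rewrite -{1}wx -wy !(inj_eq perm_inj).
    by rewrite ix iy.
  have wE i : i != x -> i != y -> (w * tperm x y)%g i = w i.
    by move=> ix iy; rewrite permM; have /andP[h1 h2] := wD _ ix iy; rewrite tpermN.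
  apply/matchingsP; split=> i; rewrite ?in_setD1.
    case: (eqVneq i x) => [->|ix]; first by rewrite !wx.
    case: (eqVneq i y) => [->|iy]; first by rewrite !wy.
    have /andP[h1 h2] := wD _ ix iy.
    by have := inv i; rewrite wE // wE.
  case: (eqVneq i y) => [->|iy]; first by rewrite wy eqxx.
  case: (eqVneq i x) => [->|ix]; first by rewrite wx eqxx.
  by rewrite -(sup i) wE.
move=> /matchingsP[inv sup].
have wx : w x = x by apply/eqP; rewrite -[_ == _]negbK sup !inE eqxx andbF.
have wy : w y = y by apply/eqP; rewrite -[_ == _]negbK sup !inE eqxx.
have wD i : i != x -> i != y -> (w i != x) && (w i != y).
  move=> ix iy; rewrite -{1}wx -wy !(inj_eq perm_inj).
  by rewrite ix iy.
have wE i : i != x -> i != y -> (w * tperm x y)%g i = w i.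
  by move=> ix iy; rewrite permM; have /andP[h1 h2] := wD _ ix iy; rewrite tpermN.
have ux : (w * tperm x y)%g x = y by rewrite permM wx tpermL.
have uy : (w * tperm x y)%g y = x by rewrite permM wy tpermR.
rewrite ux eqxx andbT; apply/matchingsP; split=> i.
  case: (eqVneq i x) => [->|ix]; first by rewrite ux uy.
  case: (eqVneq i y) => [->|iy]; first by rewrite uy ux.
  by have /andP[h1 h2] := wD _ ix iy; rewrite !wE ?inv ?wE.
case: (eqVneq i x) => [->|ix]; first by rewrite ux yx xS.
case: (eqVneq i y) => [->|iy]; first by rewrite uy xy yS.
by rewrite wE // sup !inE ix iy.
Qed.

Lemma odd_involution S w : w \in matchings S ->
  forall B : {set 'I_m}, B \subset S -> {in B, forall e, w e \in B} -> ~~ odd #|B|.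
Proof.
move=> /matchingsP[inv sup] B /subsetP BS wB.
rewrite -(cardsID [set e : 'I_m | (e < w e)%N] B).
suff -> : #|B :\: [set e : 'I_m | (e < w e)%N]| = #|B :&: [set e : 'I_m | (e < w e)%N]|.
  by rewrite addnn odd_double.
rewrite -(card_imset _ (@perm_inj _ w)); apply: eq_card => e.
apply/imsetP/idP => [[e' + ->]|].
  rewrite !inE -leqNgt inv => /andP[h1 h2]; rewrite wB //= ltn_neqAle h1 andbT.
  by have := BS _ h2; rewrite -sup.
rewrite !inE => /andP[h1 h2]; exists (w e); rewrite ?inv // !inE inv wB // andbT.
by rewrite -leqNgt ltnW.
Qed.

(** As x is the smallest element, an arc crosses {x, y} exactly when it starts strictly between x
    and y and ends after y. *)
Lemma crossings_step S x y w : x \in S -> y \in S -> x != y ->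
  {in S, forall e, (x <= e)%N} -> w \in matchings (S :\ x :\ y) ->
  crossings (w * tperm x y)%g =
  (crossings w + #|[set e : 'I_m | [&& (x < e)%N, (e < y)%N & (y < w e)%N]]|)%N.
Proof.
move=> xS yS xy xmin wm; have := wm; rewrite -(matchings_step _ xS yS xy).
set u := (w * _)%g; case/andP=> um /eqP ux.
move/matchingsP: (wm) => [winv wsup]; move/matchingsP: (um) => [uinv usup].
have wx : w x = x by apply/eqP; rewrite -[_ == _]negbK wsup !inE eqxx andbF.
have wy : w y = y by apply/eqP; rewrite -[_ == _]negbK wsup !inE eqxx.
have uy : u y = x by rewrite -ux uinv.
have uE i : i != x -> i != y -> u i = w i.
  move=> ix iy; rewrite permM tpermN //.
    by rewrite -{1}wx (inj_eq perm_inj).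
  by rewrite -{1}wy (inj_eq perm_inj).
have low (a : 'I_m) : (a < x)%N -> w a = a.
  move=> ax; apply/eqP; rewrite -[_ == _]negbK wsup !inE !negb_and.
  by apply/orP; right; apply/orP; right; apply/negP => /xmin; rewrite leqNgt ax.
have xy' : (x < y)%N by have := xmin _ yS; rewrite leq_eqVlt (negbTE (xy : (x : nat) != y)).
rewrite /crossings.
pose E := [set e : 'I_m | [&& (x < e)%N, (e < y)%N & (y < w e)%N]].
rewrite -(@card_imset _ _ (pair x) E) => [|e e' [] //].
rewrite -cardsUI addnC [X in (X + _)%N](_ : _ = 0%N) ?add0n.
  apply: eq_card => -[a b]; rewrite inE in_setU inE /=.
  have -> : ((a, b) \in pair x @: E) = (a == x) && (b \in E).
    apply/imsetP/andP => [[e eE [-> ->]]|[/eqP -> bE]] //; by exists b.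
  rewrite inE; case: (eqVneq a x) => [->|ax] /=.
    rewrite ux wx [X in X || _](_ : _ = false); last by lia.
    case: (eqVneq b x) => [->|bx]; first by rewrite ltnn.
    case: (eqVneq b y) => [->|b_y]; first by rewrite ltnn !andbF.
    by rewrite uE.
  rewrite orbF; case: (eqVneq a y) => [->|ay].
    by rewrite uy wy; lia.
  rewrite uE //; case: (eqVneq b x) => [->|bx].
    by case: (ltnP a x) => //= lax; rewrite low // (ltnNge x) (ltnW lax).
  case: (eqVneq b y) => [->|b_y]; last by rewrite uE.
  by rewrite uy wy; lia.
apply/eqP; rewrite cards_eq0; apply/eqP/setP => p; rewrite [RHS]inE in_setI inE.
apply/negP => /andP[h /imsetP[e _ pe]]; move: h; rewrite pe /=.
by rewrite wx; lia.
Qed.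

(** The elements between x and y whose arcs do not cross {x, y} are matched among themselves, hence
    even in number. This turns the crossing sign into the sign of the row expansion. *)
Lemma odd_crossing_arcs S x y w : x \in S -> y \in S -> x != y ->
  {in S, forall e, (x <= e)%N} -> w \in matchings (S :\ x :\ y) ->
  odd #|[set e : 'I_m | [&& (x < e)%N, (e < y)%N & (y < w e)%N]]| =
  odd #|[set e in S | (x < e)%N && (e < y)%N]|.
Proof.
move=> xS yS xy xmin wm; have := wm => /matchingsP[winv wsup].
set E := [set e : 'I_m | _]; set F := [set e in S | _].
have EF : E \subset F.
  apply/subsetP => e; rewrite !inE => /and3P[h1 h2 h3]; rewrite h1 h2 !andbT.
  have : w e != e by apply/eqP => we; move: h3; rewrite we; lia.
  by rewrite wsup !inE => /and3P[].
rewrite -(cardsID E F) (setIidPr EF) oddD.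
rewrite [X in _ (+) X](_ : _ = false) ?addbF //; apply/negbTE.
have SF e : e \in F :\: E -> [/\ e \in S :\ x :\ y, (x < e)%N, (e < y)%N & (w e < y)%N].
  rewrite !inE => /andP[+ /and3P[eS h1 h2]]; rewrite h1 h2 eS /= -leqNgt => h3.
  have ex : e != x by apply/eqP => e'; move: h1; rewrite e' ltnn.
  have ey : e != y by apply/eqP => e'; move: h2; rewrite e' ltnn.
  split=> //; first by rewrite ex ey.
  rewrite ltn_neqAle h3 andbT; apply/negP => /eqP /val_inj we.
  have := wsup y; rewrite !inE eqxx /= => /negbT; rewrite negbK => /eqP.
  by rewrite -we winv => e'; rewrite e' we eqxx in ey.
apply: (odd_involution wm).
  by apply/subsetP => e /SF[].
move=> e /SF[eS h1 h2 h3].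
have : w e \in S :\ x :\ y by rewrite -wsup winv eq_sym wsup.
rewrite !inE => /and3P[ey ex weS]; rewrite weS h3 winv /=.
have := xmin _ weS; rewrite leq_eqVlt eq_sym (negbTE (ex : (w e : nat) != x)) /= => ->.
by rewrite -leqNgt ltnW.
Qed.

Variables (R : comNzRingType) (A : 'M[R]_m).

Definition arcs_prod w : R := \prod_(i < m | (i < w i)%N) A i (w i).

Definition pf_on S : R :=
  \sum_(w in matchings S) (-1) ^+ crossings w * arcs_prod w.

Lemma arcs_prod_step S x y w : x \in S -> y \in S -> (x < y)%N ->
  w \in matchings (S :\ x :\ y) ->
  arcs_prod (w * tperm x y)%g = A x y * arcs_prod w.
Proof.
move=> xS yS xy; have xny : x != y by apply/eqP => e; move: xy; rewrite e ltnn.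
move=> wm; have := wm; rewrite -(matchings_step _ xS yS xny).
set u := (w * _)%g; case/andP=> um /eqP ux.
move/matchingsP: (wm) => [winv wsup]; move/matchingsP: (um) => [uinv usup].
have wx : w x = x by apply/eqP; rewrite -[_ == _]negbK wsup !inE eqxx andbF.
have wy : w y = y by apply/eqP; rewrite -[_ == _]negbK wsup !inE eqxx.
have uy : u y = x by rewrite -ux uinv.
have uE i : i != x -> i != y -> u i = w i.
  move=> ix iy; rewrite permM tpermN //.
    by rewrite -{1}wx (inj_eq perm_inj).
  by rewrite -{1}wy (inj_eq perm_inj).
rewrite /arcs_prod (bigD1 x) /= ?ux //; congr (_ * _).
rewrite (eq_bigl (fun i : 'I_m => (i < w i)%N)) => [|i].
  apply: eq_bigr => i iw; rewrite uE //; apply/eqP => e; move: iw; rewrite e.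
    by rewrite wx ltnn.
  by rewrite wy ltnn.
case: (eqVneq i x) => [->|ix]; first by rewrite wx ltnn andbF.
case: (eqVneq i y) => [->|iy]; first by rewrite uy wy ltnn; lia.
by rewrite uE // andbT.
Qed.

Lemma pf_on0 : pf_on set0 = 1.
Proof.
rewrite /pf_on (big_pred1 1%g) => [|w].
  rewrite /arcs_prod big_pred0 => [|i]; last by rewrite perm1 ltnn.
  rewrite mulr1 /crossings (_ : [set p | _] = set0) ?cards0 //.
  by apply/setP => p; rewrite !inE !perm1; lia.
apply/matchingsP/eqP => [[_ H]|->]; last by split=> i; rewrite !perm1 // eqxx inE.
by apply/permP => i; rewrite perm1; apply/eqP; have := H i; rewrite inE; case: eqP.
Qed.

(** Matchings are grouped by the partner y of x, and the arc {x, y} is removed. *)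
Lemma pf_on_step S x : x \in S -> {in S, forall e, (x <= e)%N} ->
  pf_on S = \sum_(y in S :\ x)
    (-1) ^+ #|[set e in S | (x < e)%N && (e < y)%N]| * (A x y * pf_on (S :\ x :\ y)).
Proof.
move=> xS xmin; rewrite /pf_on.
rewrite (partition_big (fun w : 'S_m => w x) (mem (S :\ x))) /=; last first.
  move=> w /matchingsP[inv sup]; rewrite !inE sup xS /= -sup inv eq_sym.
  by rewrite sup.
apply: eq_bigr => y; rewrite !inE => /andP[yx yS].
have xy : x != y by rewrite eq_sym.
have lxy : (x < y)%N by have := xmin _ yS; rewrite leq_eqVlt (negbTE (xy : (x : nat) != y)).
rewrite (reindex_inj (mulIg (tperm x y))) /=.
rewrite (eq_bigl (mem (matchings (S :\ x :\ y)))) => [|w]; last exact: matchings_step.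
rewrite !mulr_sumr; apply: eq_bigr => w wm.
rewrite (crossings_step xS yS xy xmin wm) (arcs_prod_step xS yS lxy wm).
rewrite exprD -[X in _ * X * _]signr_odd (odd_crossing_arcs xS yS xy xmin wm) signr_odd.
by ring.
Qed.

Lemma pfs_pf_on (s : seq 'I_m) : sorted ltn [seq val i | i <- s] ->
  pfs (fun i j => A i j) s = pf_on [set i in s].
Proof.
have [k] := ubnP (size s); elim: k s => // k IH [|x s] /=.
  by rewrite pfs_nil set_nil pf_on0.
rewrite ltnS => sk ps.
move: (ps); rewrite (path_sortedE ltn_trans) => /andP[/allP xlt ss].
have us : uniq s.
  by rewrite -(map_inj_uniq val_inj) (sorted_uniq ltn_trans ltnn).
have xs e : e \in s -> (x < e)%N by move=> es; apply: xlt; rewrite map_f.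
have xns : x \notin s by apply/negP => /xs; rewrite ltnn.
have S1 : [set i in x :: s] :\ x = [set i in s].
  by apply/setP => i; rewrite !inE; case: eqP => [->|] //=; rewrite (negbTE xns).
rewrite pfs_cons ctr_sum // (@pf_on_step _ x); last first.
- by move=> e; rewrite !inE => /orP[/eqP ->|/xs /ltnW].
- by rewrite !inE eqxx.
rewrite S1 [RHS](eq_bigl (mem s)) => [|y]; last by rewrite inE.
rewrite -big_uniq //= !big_seq; apply: eq_bigr => y ys.
have -> : #|[set e in [set i in x :: s] | (x < e)%N && (e < y)%N]| = index y s.
  rewrite (index_sorted ss ys) -size_filter -(card_uniqP _) ?filter_uniq //.
  apply: eq_card => e; rewrite !inE mem_filter.
  case: (eqVneq e x) => [->|_] /=; first by rewrite ltnn (negbTE xns) andbF.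
  by case: (boolP (e \in s)) => [/xs -> /=|_]; rewrite ?andbT ?andbF.
congr (_ * (_ * _)); rewrite IH; last first.
- rewrite rem_filter //; apply: (subseq_sorted ltn_trans _ ss).
  by apply: map_subseq; apply: filter_subseq.
- by rewrite size_rem // (leq_ltn_trans (leq_pred _)).
congr pf_on; apply/setP => i; rewrite !inE mem_rem_uniq // inE.
Qed.

Lemma pf_pfs : pf A = pfs (fun i j => A i j) (enum 'I_m).
Proof.
rewrite pfs_pf_on; last first.
  by rewrite val_enum_ord; apply: iota_ltn_sorted.
rewrite /pf /pf_on; apply: eq_bigl => w.
apply/andP/matchingsP => [[]|[inv sup]].
  rewrite inE expgS expg1 => /eqP w2 /forallP wN; split=> i.
    by rewrite -permM w2 perm1.
  by rewrite !inE mem_enum wN.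
split; last by apply/forallP => i; rewrite sup !inE mem_enum.
by rewrite inE expgS expg1; apply/eqP/permP => i; rewrite permM perm1 inv.
Qed.

End PfaffianAsSum.

Lemma pf_principal_sub (R : comNzRingType) n (A : 'M[R]_n) (S : {set 'I_n}) :
  pf (principal_sub A S) = pfs (fun i j => A i j) (enum S).
Proof.
have <- : [seq enum_val (A := mem S) i | i <- enum 'I_#|S|] = enum S.
  case: (set_0Vmem S) => [S0|[x _]].
    rewrite [RHS](_ : _ = [::]); last by rewrite S0 enum_set0.
    by apply: size0nil; rewrite size_map size_enum_ord S0 cards0.
  rewrite -[RHS](mkseq_nth x) -cardE /mkseq -val_enum_ord -map_comp.
  by apply: eq_map => i /=; rewrite (enum_val_nth x).
rewrite pf_pfs [RHS]pfs_map; apply: eq_pfs => i j _ _.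
by rewrite !mxE.
Qed.

(** * Leading monomials *)

Section LeadMonomial.

Variables (K : closedFieldType) (n : nat).
Implicit Types (f g : ssring K n) (m M : 'X_{1..nvars n}) (p q v : lowpair n).

Definition lead f M : Prop :=
  f@_M != 0 /\ forall m, m \in msupp f -> m != M -> revlex_lt m M.

Lemma lead_init f M : lead f M -> is_init f 'X_[M].
Proof.
case=> h1 h2; right; exists M; split=> //.
by rewrite mcoeff_msupp.
Qed.

Lemma leadN (b : bool) f M : lead f M -> lead ((-1) ^+ b * f) M.
Proof.
case: b => h; last by rewrite mul1r.
rewrite expr1 mulN1r; case: h => h1 h2; split; first by rewrite mcoeffN oppr_eq0.
by move=> m; rewrite (perm_mem (msuppN f)); apply: h2.
Qed.

Lemma lead1 : lead 1 0%MM.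
Proof.
split; first by rewrite mcoeff1 eqxx oner_neq0.
by move=> m; rewrite msupp1 inE => ->.
Qed.

Lemma leadMX f M m : lead f M -> lead (f * 'X_[m]) (M + m)%MM.
Proof.
case=> h1 h2; split; first by rewrite addmC mcoeffMX.
move=> m'; rewrite (perm_mem (msuppMX _ _)) => /mapP[m'' h ->].
by rewrite addmC (inj_eq (@addIm _ m)) revlex_add2r; apply: h2.
Qed.

Lemma lead_exists f : f != 0 -> exists M, lead f M.
Proof.
move=> f0; have : has predT (msupp f).
  by rewrite has_predT lt0n size_eq0 msupp_eq0.
case/revlex_max => M [h1 _ h2]; exists M; split; first by rewrite -mcoeff_msupp.
by move=> m mf; apply: h2.
Qed.

(** Such terms are negligible against monomials of the same degree in variables up to [v]. Zero
    qualifies, which is what makes zeroed entries harmless. *)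
Definition beyond v f : Prop := forall m, m \in msupp f ->
  exists2 p, (vrank v < vrank p)%N & (0 < m (enum_rank p))%N.

Lemma beyond0 v : beyond v 0.
Proof. by move=> m; rewrite msupp0. Qed.

Lemma beyondB v f g : beyond v f -> beyond v g -> beyond v (f - g).
Proof. by move=> h1 h2 m /msuppB_le; rewrite mem_cat => /orP[/h1|/h2]. Qed.

Lemma beyondM v f g : beyond v f -> beyond v (f * g).
Proof.
move=> h m /msuppM_le /allpairsP[[m1 m2] /= [/h [p h1 h2] _ ->]].
by exists p; rewrite // mnmDE ltn_addr.
Qed.

Lemma beyondX v c p : (vrank v < vrank p)%N -> beyond v (c *: 'X_(enum_rank p)).
Proof.
move=> h m /msuppZ_le; rewrite msuppX inE => /eqP ->.
by exists p; rewrite // mnm1E eqxx.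
Qed.

Lemma beyond_ctr (T : eqType) (h : T -> ssring K n) phi (s : seq T) v :
  {in s, forall y, beyond v (h y)} -> beyond v (ctr h phi s).
Proof.
elim: s phi => [|y s IH] phi H /=; first exact: beyond0.
apply: beyondB; first by apply: beyondM; apply: H; rewrite mem_head.
by apply: IH => x xs; apply: H; rewrite inE xs orbT.
Qed.

Lemma pfs_homog (T : eqType) (a : T -> T -> ssring K n) s :
  (forall x y, a x y \is 1.-homog) -> pfs a s \is ((size s)./2).-homog.
Proof.
move=> ha; have [k] := ubnP (size s); elim: k s => [//|k IH] [|x s].
  by rewrite pfs_nil dhomog1.
rewrite ltnS => sk; rewrite pfs_cons.
suff W (phi : seq T -> ssring K n) (w : seq T) d :
    (forall u, (size u).+1 = size w -> phi u \is d.-homog) ->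
    ctr (a x) phi w \is d.+1.-homog.
  case: s sk => [|y s] sk; first exact: dhomog0.
  have -> : (size [:: x, y & s])./2 = (size s)./2.+1 by [].
  by apply: W => u [su]; rewrite -su; apply: IH; rewrite su ltnW.
elim: w phi => [|y w IHw] phi H /=; first exact: dhomog0.
apply: rpredB; first by rewrite -add1n; apply: dhomogM (ha _ _) _; apply: H.
by apply: IHw => u su; apply: H; rewrite /= su.
Qed.

(** Every term of the expansion along x except the pivot term contains a variable larger than [v],
    while the candidate monomial uses none; since the Pfaffian is homogeneous, [revlex_largest_var]
    decides. *)
Lemma lead_pfs_step (T : eqType) (a : T -> T -> ssring K n) x y0 s v c M :
  (forall x y, a x y \is 1.-homog) ->
  c != 0 -> a x y0 = c *: 'X_(enum_rank v) ->
  {in s, forall y, beyond v (a x y)} ->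
  lead (pfs a s) M ->
  (forall q, (0 < M (enum_rank q))%N -> (vrank q < vrank v)%N) ->
  lead (pfs a (x :: y0 :: s)) (U_(enum_rank v) + M)%MM.
Proof.
move=> ha c0 axy bs leads Mv.
have /dhomogP hom := pfs_homog (x :: y0 :: s) ha.
have E : pfs a (x :: y0 :: s) = c *: (pfs a s * 'X_(enum_rank v)) -
    ctr (a x) (fun w => pfs a (y0 :: w)) s.
  by rewrite pfs_cons /= axy -scalerAl [_ * 'X_(_)]mulrC.
set g := ctr _ _ _ in E; have bg : beyond v g by apply: beyond_ctr.
have lead1 := leadMX U_(enum_rank v) leads; rewrite addmC in lead1.
set M' := (_ + _)%MM in lead1 *.
have M'v q : (0 < M' (enum_rank q))%N -> (vrank q <= vrank v)%N.
  rewrite mnmDE addn_gt0 mnm1E lt0b => /orP[/eqP/enum_rank_inj -> //|/Mv].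
  exact: ltnW.
have gM' : g@_M' = 0.
  apply: memN_msupp_eq0; apply/negP => /bg[p h1 h2].
  by have := M'v p h2; rewrite leqNgt h1.
have degM' : mdeg M' = (size s).+2./2.
  apply: hom; rewrite mcoeff_msupp E mcoeffB gM' subr0 mcoeffZ.
  by rewrite mulf_neq0 //; case: lead1.
split; first by rewrite E mcoeffB gM' subr0 mcoeffZ mulf_neq0 //; case: lead1.
move=> m ms mM'; have degm : mdeg m = (size s).+2./2 by apply: hom.
move: ms; rewrite E => /msuppB_le; rewrite mem_cat => /orP[/msuppZ_le|/bg[p h1 h2]].
  by move=> h; case: lead1 => _; apply.
apply: (revlex_largest_var (p := p)) => //; first by rewrite degm degM'.
by move=> q /M'v h; apply: leq_ltn_trans h h1.
Qed.

End LeadMonomial.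

Section GenericMatrix.

Variables (K : closedFieldType) (n : nat).
Definition genU (i j : 'I_n) : ssring K n := U_ss K n i j.
Local Notation U := genU.

Lemma uvar_homog (i j : 'I_n) : uvar K i j \is 1.-homog.
Proof.
rewrite /uvar; case: insubP => [p _ _|_]; last exact: dhomog0.
by rewrite dhomogX; apply/eqP/mdeg1.
Qed.

Lemma genU_skew i j : U i j = - U j i.
Proof. by rewrite /genU !mxE; case: ltngtP; rewrite ?opprK ?oppr0. Qed.

Lemma genU_diag i : U i i = 0.
Proof. by rewrite /genU mxE ltnn. Qed.

Lemma genU_homog i j : U i j \is 1.-homog.
Proof.
by rewrite /genU mxE; do 2?case: ifP => _; rewrite ?rpredN ?uvar_homog ?dhomog0.
Qed.

Lemma genU_low (p : lowpair n) i j : val p = (i, j) ->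
  U i j = 'X_(enum_rank p) /\ U j i = - 'X_(enum_rank p).
Proof.
move=> e; have ji : (j < i)%N by have := valP p; rewrite e.
have E : uvar K i j = 'X_(enum_rank p).
  by rewrite /uvar; have -> : (i, j) = val p by []; rewrite valK.
by rewrite /genU !mxE ji ltnNge (ltnW ji) /= E.
Qed.

Lemma lowpair_exists (i j : 'I_n) : (j < i)%N -> exists p : lowpair n, val p = (i, j).
Proof. by move=> ji; exists (exist _ (i, j) ji). Qed.

Local Notation zb := (zero_block U).

Lemma zero_block_homog x y : zb x y \is 1.-homog.
Proof. by rewrite /zero_block; case: ifP => _; rewrite ?dhomog0 ?genU_homog. Qed.

Lemma genU_beyond (v : lowpair n) (x e : 'I_n) : ((val v).1 <= x)%N -> (e <= x)%N ->
  ((val v).2 < e)%N -> beyond v (U x e).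
Proof.
move=> vx; rewrite leq_eqVlt => /orP[/eqP/val_inj -> _|ex ve].
  by rewrite genU_diag; apply: beyond0.
have [p vp] := lowpair_exists ex; have [-> _] := genU_low vp.
rewrite -[X in beyond _ X]scale1r; apply: beyondX.
rewrite -var_ltE /var_lt vp /= ve; move: vx; rewrite leq_eqVlt => /orP[|->] //.
by move/eqP/val_inj => ->; rewrite eqxx orbT.
Qed.

Lemma zero_block_beyond (v : lowpair n) b (x : 'I_n) (y : bool * 'I_n) : ((val v).1 <= x)%N ->
  (~~ (b && y.1) -> (y.2 <= x)%N /\ ((val v).2 < y.2)%N) -> beyond v (zb (b, x) y).
Proof.
move=> vx; rewrite /zero_block /=; case: ifP => _ H; first exact: beyond0.
by case: H => // h1 h2; apply: genU_beyond.
Qed.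

Lemma lead_zpf_perm L S w M : perm_eq (map (@tagl _) L ++ map (@tagr _) S) w ->
  lead (pfs zb w) M -> lead (zpf U L S) M.
Proof.
move=> pw; have [b e] := pfs_perm (zero_block_skew genU_skew) (zero_block_diag genU_diag) pw.
by rewrite /zpf e; apply: leadN.
Qed.

End GenericMatrix.

(** * Pfaffians led by divisors of antidiagonal chains *)

Section Chains.

Variables (K : closedFieldType) (n : nat).
Implicit Types (x y : 'I_n * 'I_n) (ps gs : seq ('I_n * 'I_n)) (L S : seq 'I_n).
Implicit Types (M : 'X_{1..nvars n}) (q v : lowpair n).
Local Notation U := (genU K (n:=n)).
Local Notation zb := (zero_block U).

Definition antidiag x y := (x.1 < y.1)%N && (y.2 < x.2)%N.

Definition chain ps := pairwise antidiag ps && all (fun x => x.1 != x.2) ps.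

Definition occurs (e : 'I_n) ps := (e \in unzip1 ps) || (e \in unzip2 ps).

Lemma occursP e ps : reflect (exists2 x, x \in ps & e = x.1 \/ e = x.2) (occurs e ps).
Proof.
apply: (iffP orP) => [[/mapP[x xs ->]|/mapP[x xs ->]]|[x xs [->|->]]].
- by exists x => //; left.
- by exists x => //; right.
- by left; apply: map_f.
- by right; apply: map_f.
Qed.

Definition squarefree_on M ps := forall q,
  (M (enum_rank q) <= 1)%N /\
  ((0 < M (enum_rank q))%N -> val q \in ps \/ swap (val q) \in ps).

Lemma squarefree_step v M ps ps' :
  squarefree_on M ps' -> {subset ps' <= ps} ->
  val v \in ps \/ swap (val v) \in ps ->
  (forall q, (0 < M (enum_rank q))%N -> (vrank q < vrank v)%N) ->
  squarefree_on (U_(enum_rank v) + M)%MM ps.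
Proof.
move=> sM sub vps Mv q; rewrite mnmDE mnm1E (inj_eq enum_rank_inj).
case: eqVneq => [<-|_] /=; last first.
  rewrite add0n; have [h1 h2] := sM q; split=> // /h2.
  by case=> /sub h; [left|right].
case: (posnP (M (enum_rank v))) => [-> //|/Mv].
by rewrite ltnn.
Qed.

(* Arcs (x.1, x.2) that are nested, the head of the list being outermost. *)
Lemma lead_nested gs : chain gs -> all (fun x => x.1 < x.2)%N gs ->
  exists S M, [/\ lead (zpf U [::] S) M, squarefree_on M gs,
    size S = (2 * size gs)%N & {in S, forall e, occurs e gs}].
Proof.
elim: gs => [|[a b] gs IH].
  move=> _ _; exists [::], 0%MM; split=> //; first exact: lead1.
  by move=> q; rewrite mnmE.
rewrite /chain /= => /andP[/andP[/allP ab pw] /andP[nab ne]] /andP[/= lab lt].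
have [||S [M [ld sf sz oc]]] := IH; rewrite /chain ?pw //.
have [v vE] := lowpair_exists lab.
have inside e : occurs e gs -> (a < e < b)%N.
  case/occursP => x xs; have /andP[/= h1 h2] := ab _ xs.
  have h3 := allP lt _ xs; have hne := allP ne _ xs.
  by case=> ->; lia.
have Mv q : (0 < M (enum_rank q))%N -> (vrank q < vrank v)%N.
  move=> h; rewrite -var_ltE /var_lt vE /=.
  have [_ /(_ h) qs] := sf q.
  suff -> : ((val q).1 < b)%N by [].
  have : occurs (val q).1 gs.
    by apply/occursP; case: qs => qs; [exists (val q)|exists (swap (val q))]; rewrite //=; [left|right].
  by move/inside/andP => [].
exists [:: b, a & S], (U_(enum_rank v) + M)%MM; split.
(* The pivot row b is the largest index in play and the remaining columns lie strictly between a and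
   b, so (b, a) is the smallest variable of the row. *)
- apply: (lead_pfs_step (c := 1) (v := v)) ld Mv.
  + exact: zero_block_homog.
  + exact: oner_neq0.
  + by rewrite scale1r /zero_block /=; have [-> _] := genU_low K vE.
  + move=> _ /mapP[e eS ->]; apply: zero_block_beyond; rewrite vE //= => _.
    by have /andP[h1 h2] := inside e (oc e eS); rewrite h1 ltnW.
- apply: squarefree_step sf _ _ Mv; first by move=> x xs; rewrite inE xs orbT.
  by right; rewrite vE mem_head.
- by rewrite /= sz; lia.
- move=> e; rewrite !inE => /or3P[/eqP->|/eqP->|/oc /occursP[x xs ex]]; apply/occursP.
  + by exists (a, b); [rewrite mem_head|right].
  + by exists (a, b); [rewrite mem_head|left].
  + by exists x => //; rewrite inE xs orbT.
Qed.

Lemma chain_rev_swap ps : chain ps -> chain (rev (map (@swap n) ps)).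
Proof.
case/andP=> pw ne; apply/andP; split.
  elim: ps pw {ne} => //= x ps IH /andP[/allP h1 h2].
  rewrite rev_cons pairwise_rcons IH // andbT; apply/allP => y.
  by rewrite mem_rev => /mapP[z /h1 h ->]; rewrite /antidiag /= andbC.
rewrite all_rev all_map; apply: sub_all ne => x /=.
by rewrite eq_sym.
Qed.

Lemma occurs_rev_swap ps e : occurs e (rev (map (@swap n) ps)) -> occurs e ps.
Proof.
case/occursP=> x; rewrite mem_rev => /mapP[y ys ->] /= h; apply/occursP.
by exists y => //; case: h; [right|left].
Qed.

Lemma chain_filter (P : pred ('I_n * 'I_n)) ps : chain ps -> chain (filter P ps).
Proof.
case/andP=> h1 /allP h2; rewrite /chain pairwise_filter //=.
by apply/allP => x; rewrite mem_filter => /andP[_ /h2].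
Qed.

(** The pairs above the diagonal are nested arcs, and so are those below after transposition. The
    larger family has at least half of the pairs, and its Pfaffian has twice as many indices as
    arcs. *)
Lemma lead_chain_box ps : chain ps ->
  exists S M, [/\ lead (zpf U [::] S) M, squarefree_on M ps,
    (size ps <= size S)%N & {in S, forall e, occurs e ps}].
Proof.
move=> cps; pose up x := (x.1 < x.2)%N; pose down x := (x.2 < x.1)%N.
have sz : size ps = (size (filter up ps) + size (filter down ps))%N.
  rewrite !size_filter -(count_predC up); congr addn; apply: eq_in_count => x xs /=.
  have := allP (andP cps).2 x xs; rewrite /up /down /= -val_eqE /=.
  by rewrite -leqNgt leq_eqVlt eq_sym => /negbTE ->.
case: (leqP (size (filter down ps)) (size (filter up ps))) => le.
  have [S [M [h1 h2 h3 h4]]] := lead_nested (chain_filter up cps) (filter_all _ _).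
  exists S, M; split=> //; last 2 first.
  - by rewrite h3; lia.
  - move=> e /h4/occursP[x]; rewrite mem_filter => /andP[_ xs] h.
    by apply/occursP; exists x.
  move=> q; have [g1 g2] := h2 q; split=> // /g2.
  by rewrite !mem_filter => -[/andP[_ h]|/andP[_ h]]; [left|right].
have [|S [M [h1 h2 h3 h4]]] := lead_nested (chain_rev_swap (chain_filter down cps)).
  rewrite all_rev all_map; apply: sub_all (filter_all down ps) => x.
  by rewrite /down.
exists S, M; split=> //; last 2 first.
- by rewrite h3 size_rev size_map; lia.
- move=> e /h4/occurs_rev_swap/occursP[x]; rewrite mem_filter => /andP[_ xs] h.
  by apply/occursP; exists x.
move=> q; have [g1 g2] := h2 q; split=> // /g2; rewrite !mem_rev.
case=> /mapP[x]; rewrite mem_filter => /andP[_ xs] e; [right|left].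
  by rewrite e swapK.
by rewrite (can_inj (@swapK n) e).
Qed.

(* The zeroed block [L] collects the first entries of the pairs that reach     *)
(* beyond [j], together with the pairs crossing them; once all the remaining   *)
(* pairs lie in [j] and inside the arcs already used, the longer of the two    *)
(* nested families (x.1 < x.2 or x.1 > x.2) is enough.                         *)
Lemma lead_chain (j : nat) ps : chain ps -> all (fun x => x.2 <= j)%N ps ->
  exists L S M, [/\ lead (zpf U L S) M, squarefree_on M ps,
    (size ps <= size S)%N /\ {in S, forall e : 'I_n, (e <= j)%N},
    {in L, forall e, occurs e ps} /\ {in S, forall e, occurs e ps}
    & {in S, forall e : 'I_n, exists2 x, x \in ps & (x.2 <= e)%N}].
Proof.
have [k] := ubnP (size ps); elim: k ps => // k IH ps.
case: (lastP ps) => [|ps0 z] sk cps bnd.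
  exists [::], [::], 0%MM; split=> //; first exact: lead1.
  by move=> q; rewrite mnmE.
set ps1 := rcons ps0 z in sk cps bnd *.
have zps : z \in ps1 by rewrite mem_rcons mem_head.
have [h [ps2 eps]] : exists h ps2, ps1 = h :: ps2.
  by rewrite /ps1; case: (ps0) => [|h t]; [exists z, [::]|exists h, (rcons t z)].
have hps : h \in ps1 by rewrite eps mem_head.
have [pw ne] := andP cps.
have lastz x : x \in ps1 -> x = z \/ x \in ps0 /\ (x.1 < z.1)%N /\ (z.2 < x.2)%N.
  rewrite mem_rcons inE => /orP[/eqP|xs]; [by left|right]; split=> //.
  by move: pw; rewrite pairwise_rcons => /andP[/allP/(_ x xs)/andP].
have headh x : x \in ps1 -> x = h \/ x \in ps2 /\ (h.1 < x.1)%N /\ (x.2 < h.2)%N.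
  rewrite eps inE => /orP[/eqP|xs]; [by left|right]; split=> //.
  by move: pw; rewrite eps pairwise_cons => /andP[/allP/(_ x xs)/andP].
have neq x : x \in ps1 -> (x.1 : nat) != x.2 by move/(allP ne).
have sub0 : {subset ps0 <= ps1} by move=> x xs; rewrite mem_rcons inE xs orbT.
have sub2 : {subset ps2 <= ps1} by move=> x xs; rewrite eps inE xs orbT.
have szps : size ps1 = (size ps0).+1 by rewrite size_rcons.
have szps' : size ps1 = (size ps2).+1 by rewrite eps.
have hz1 : (h.1 <= z.1)%N by case: (lastz h hps) => [->//|[_ [/ltnW]]].
have zh2 : (z.2 <= h.2)%N by case: (lastz h hps) => [->//|[_ [_ /ltnW]]].
(* If the test fails, all entries are at most j and at least z.2, so the unmodified Pfaffian of
   [lead_chain_box] is enough. *)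
case: (boolP ((j < z.1)%N || (h.1 < z.2)%N)) => [cA|]; last first.
  rewrite negb_or -!leqNgt => /andP[zj zh].
  have [S [M [h1 h2 h3 h4]]] := lead_chain_box cps.
  exists [::], S, M; split=> //.
    split=> // e /h4/occursP[x xs [->|->]]; last exact: (allP bnd).
    by apply: leq_trans zj; case: (lastz x xs) => [->//|[_ [/ltnW]]].
  move=> e /h4/occursP[x xs [->|->]]; last by exists x.
  exists z => //; apply: leq_trans zh _.
  by case: (headh x xs) => [->//|[_ [/ltnW]]].
have occ0 e : occurs e ps0 -> occurs e ps1.
  by case/occursP => x /sub0 xs h0; apply/occursP; exists x.
have occ2 e : occurs e ps2 -> occurs e ps1.
  by case/occursP => x /sub2 xs h0; apply/occursP; exists x.
(* The largest index in play is z.1 or h.2. It becomes the pivot row, and its pair is removed from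
   the corresponding end of the chain. *)
case: (leqP h.2 z.1) => hz.
  have zlt : (z.2 < z.1)%N by have := neq z zps; lia.
  have [v vE] := lowpair_exists zlt.
  have [||| L [S [M [ld sf [sz Sj] [oL oS] mn]]]] := IH ps0.
  - by move: sk; rewrite szps.
  - move: pw ne; rewrite /ps1 pairwise_rcons all_rcons => /andP[_ pw0] /andP[_ ne0].
    by rewrite /chain pw0.
  - by apply/allP => x /sub0; apply: (allP bnd).
  have le0 e : occurs e ps0 -> (e <= z.1)%N.
    case/occursP => x xs [->|->].
      by case: (lastz x (sub0 _ xs)) => [->//|[_ [/ltnW]]].
    by apply: leq_trans hz; case: (headh x (sub0 _ xs)) => [->//|[_ [_ /ltnW]]].
  have lt0 x : x \in ps0 -> (x.1 < z.1)%N /\ (z.2 < x.2)%N.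
    by move: pw; rewrite pairwise_rcons => /andP[/allP H _] /H/andP.
  have Mv q : (0 < M (enum_rank q))%N -> (vrank q < vrank v)%N.
    move=> h0; rewrite -var_ltE /var_lt vE /=; have [_ /(_ h0)[qs|qs]] := sf q.
      by have [-> _] := lt0 _ qs.
    have := le0 (val q).1; rewrite leq_eqVlt => le1.
    have : occurs (val q).1 ps0 by apply/occursP; exists (swap (val q)) => //; right.
    move/le1/orP => [/eqP e1|-> //].
    case: (headh _ (sub0 _ qs)) => [eh|[_ [_]]]; last by rewrite /= e1 ltnNge hz.
    have e2 : (val q).2 = h.1 by rewrite -eh.
    (* A tie in the first coordinate means h.2 = z.1, which is at most j; then [cA] gives h.1 < z.2
       and the second coordinate decides. *)
    have e3 : (val q).1 = h.2 by rewrite -eh.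
    have hb := allP bnd h hps; rewrite (val_inj e1) eqxx e2.
    by apply/orP; right; case/orP: cA => //; rewrite -e1 e3 ltnNge hb.
  exists (z.1 :: L), (z.2 :: S), (U_(enum_rank v) + M)%MM; split.
  - apply: (@lead_zpf_perm _ _ _ _
      (tagl z.1 :: tagr z.2 :: (map (@tagl _) L ++ map (@tagr _) S))).
      by rewrite /= perm_cons -cat1s -[X in perm_eq _ X]cat1s perm_catCA.
    apply: (lead_pfs_step (c := 1) (v := v)) ld Mv.
    + exact: zero_block_homog.
    + exact: oner_neq0.
    + by rewrite scale1r /zero_block /=; have [-> _] := genU_low K vE.
    + move=> y; rewrite mem_cat => /orP[/mapP[e eL ->]|/mapP[e eS ->]].
        by apply: zero_block_beyond; rewrite ?vE.
      apply: zero_block_beyond; rewrite vE //= => _; split; first by apply: le0; apply: oS.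
      by have [x xs xe] := mn e eS; apply: leq_trans xe; case: (lt0 x xs).
  - by apply: squarefree_step sf sub0 _ Mv; left; rewrite vE -surjective_pairing.
  - split; first by rewrite szps.
    by move=> e; rewrite inE => /orP[/eqP->|/Sj //]; apply: (allP bnd).
  - split=> e; rewrite inE => /orP[/eqP->|].
    + by apply/occursP; exists z => //; left.
    + by move/oL/occ0.
    + by apply/occursP; exists z => //; right.
    + by move/oS/occ0.
  - move=> e; rewrite inE => /orP[/eqP->|/mn[x /sub0 xs xe]]; first by exists z.
    by exists x.
have hj := allP bnd h hps.
(* Here z.1 < h.2 <= j, so only the second alternative of [cA] remains, and all other indices lie
   strictly between h.1 and h.2. *)
have hz2 : (h.1 < z.2)%N by case/orP: cA => //; lia.
have hlt : (h.1 < h.2)%N by apply: leq_trans hz2 zh2.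
have [v vE] := lowpair_exists hlt.
have [||| L [S [M [ld sf [sz Sj] [oL oS] mn]]]] := IH ps2.
- by move: sk; rewrite szps'.
- move: pw ne; rewrite eps /= => /andP[_ pw0] /andP[_ ne0].
  by rewrite /chain pw0.
- by apply/allP => x /sub2; apply: (allP bnd).
have lt0 x : x \in ps2 -> (h.1 < x.1)%N /\ (x.2 < h.2)%N.
  by move: pw; rewrite eps pairwise_cons => /andP[/allP H _] /H/andP.
have in2 e : occurs e ps2 -> (h.1 < e < h.2)%N.
  case/occursP => x xs; have [g1 g2] := lt0 x xs; case=> ->.
    rewrite g1 /=; apply: leq_ltn_trans hz.
    by case: (lastz x (sub2 _ xs)) => [->//|[_ [/ltnW]]].
  rewrite g2 andbT; apply: leq_trans hz2 _.
  by case: (lastz x (sub2 _ xs)) => [->//|[_ [_ /ltnW]]].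
have Mv q : (0 < M (enum_rank q))%N -> (vrank q < vrank v)%N.
  move=> h0; rewrite -var_ltE /var_lt vE /=; have [_ /(_ h0) qs] := sf q.
  have : occurs (val q).1 ps2.
    by apply/occursP; case: qs => qs; [exists (val q)|exists (swap (val q))];
      rewrite //=; [left|right].
  by case/in2/andP => _ ->.
exists (h.1 :: L), (h.2 :: S), (U_(enum_rank v) + M)%MM; split.
- apply: (@lead_zpf_perm _ _ _ _
    (tagr h.2 :: tagl h.1 :: (map (@tagl _) L ++ map (@tagr _) S))).
    apply/permPl.
    exact: (perm_catCA (map (@tagl _) (h.1 :: L)) [:: tagr h.2] (map (@tagr _) S)).
  apply: (lead_pfs_step (c := 1) (v := v)) ld Mv.
  + exact: zero_block_homog.
  + exact: oner_neq0.
  + by rewrite scale1r /zero_block /=; have [-> _] := genU_low K vE.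
  + move=> y; rewrite mem_cat => /orP[/mapP[e eL ->]|/mapP[e eS ->]];
    apply: zero_block_beyond; rewrite vE //= => _.
      by have /andP[g1 g2] := in2 e (oL e eL); rewrite g1 ltnW.
    by have /andP[g1 g2] := in2 e (oS e eS); rewrite g1 ltnW.
- by apply: squarefree_step sf sub2 _ Mv; right; rewrite vE /swap /= -surjective_pairing.
- split; first by rewrite szps'.
  by move=> e; rewrite inE => /orP[/eqP->|/Sj //].
- split=> e; rewrite inE => /orP[/eqP->|].
  + by apply/occursP; exists h => //; left.
  + by move/oL/occ2.
  + by apply/occursP; exists h => //; right.
  + by move/oS/occ2.
- move=> e; rewrite inE => /orP[/eqP->|/mn[x /sub2 xs xe]]; first by exists h.
  by exists x.
Qed.

End Chains.

(** * The monomial ideal *)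

Section IdealGen.

Variables (P : comNzRingType) (S : P -> Prop).

Lemma ideal_gen_mem f : S f -> ideal_gen S f.
Proof.
move=> Sf; exists [:: (1, f)]; rewrite big_seq1 mul1r; split=> // c.
by rewrite inE => /eqP ->.
Qed.

Lemma ideal_gen0 : ideal_gen S 0.
Proof. by exists [::]; rewrite big_nil. Qed.

Lemma ideal_genD f g : ideal_gen S f -> ideal_gen S g -> ideal_gen S (f + g).
Proof.
move=> [s [h1 ->]] [t [h2 ->]]; exists (s ++ t); rewrite big_cat; split=> // c.
by rewrite mem_cat => /orP[/h1|/h2].
Qed.

Lemma ideal_genM f g : ideal_gen S g -> ideal_gen S (f * g).
Proof.
move=> [s [h ->]]; exists [seq (f * c.1, c.2) | c <- s].
split=> [c /mapP[c' /h h' ->] //|].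
by rewrite big_map mulr_sumr; apply: eq_bigr => c _; rewrite mulrA.
Qed.

Lemma ideal_genB f g : ideal_gen S f -> ideal_gen S g -> ideal_gen S (f - g).
Proof. by move=> h1 h2; rewrite -mulN1r; apply/ideal_genD/ideal_genM. Qed.

End IdealGen.

Lemma pairwise_zip (T1 T2 : Type) (r1 : rel T1) (r2 : rel T2) s t :
  size s = size t -> pairwise r1 s -> pairwise r2 t ->
  pairwise (fun x y => r1 x.1 y.1 && r2 x.2 y.2) (zip s t).
Proof.
elim: s t => [|x s IH] [|y t] //= [e] /andP[a1 p1] /andP[a2 p2].
rewrite IH // andbT; elim: s t e a1 a2 {IH p1 p2} => [|x' s IH] [|y' t] //= [e].
by move=> /andP[-> a1] /andP[-> a2] /=; apply: IH.
Qed.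

Section ChainMonomials.

Variables (K : closedFieldType) (n : nat).
Implicit Types (x y : 'I_n * 'I_n) (ps : seq ('I_n * 'I_n)) (A B : {set 'I_n}).
Implicit Types (m M : 'X_{1..nvars n}) (q v : lowpair n) (z : nat -> nat).
Local Notation U := (genU K (n:=n)).

Definition pair_mon x : 'X_{1..nvars n} :=
  if insub x is Some q then U_(enum_rank (q : lowpair n))%MM else 0%MM.

Lemma pair_monE x q : pair_mon x (enum_rank q) = (x == val q).
Proof.
rewrite /pair_mon; case: insubP => [v _ vE|nx].
  by rewrite mnm1E (inj_eq enum_rank_inj) -val_eqE /= vE.
by rewrite mnmE; case: eqP => // e; move: nx; rewrite e (valP q).
Qed.

Definition chain_mon ps : 'X_{1..nvars n} :=
  (\sum_(p : 'I_n * 'I_n | (p.2 < p.1)%N &&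
          ((p \in ps) || ((p.2, p.1) \in ps))) pair_mon p)%MM.

Lemma chain_monE ps q :
  chain_mon ps (enum_rank q) = (val q \in ps) || (swap (val q) \in ps).
Proof.
rewrite /chain_mon mnm_sumE; under eq_bigr do rewrite pair_monE.
case: (boolP (_ || _)) => h.
  rewrite (bigD1 (val q)) /=; last by rewrite (valP q).
  by rewrite eqxx big1 // => p /andP[_ /negbTE ->].
by rewrite big1 // => p; case: eqP => // ->; rewrite /= (negbTE h) andbF.
Qed.

Lemma u_ssE A B : ~~ has (fun p => p.1 == p.2) (odot A B) ->
  u_ss K A B = 'X_[chain_mon (odot A B)].
Proof.
rewrite /u_ss => /negbTE ->; rewrite /chain_mon -mprodXE.
apply: eq_bigr => p /andP[h _]; rewrite /uvar /pair_mon -surjective_pairing.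
by case: insubP => // /negP; rewrite h.
Qed.

Lemma sorted_enum_set A : sorted ltn [seq val i | i <- enum A].
Proof.
rewrite /enum_mem; apply: (subseq_sorted ltn_trans) (map_subseq val (filter_subseq _ _)) _.
by rewrite -enumT val_enum_ord iota_ltn_sorted.
Qed.

Lemma pairwise_enum_set A : pairwise (fun i j : 'I_n => i < j)%N (enum A).
Proof.
have := sorted_enum_set A; rewrite sorted_pairwise; last exact: ltn_trans.
by rewrite pairwise_map.
Qed.

Lemma pairwise_rev (T : Type) (r : rel T) s :
  pairwise r (rev s) = pairwise (fun a b : T => r b a) s.
Proof.
elim: s => //= x s IH; rewrite rev_cons pairwise_rcons IH; congr (_ && _).
by rewrite all_rev.
Qed.

Lemma chain_odot A B : #|A| = #|B| ->
  ~~ has (fun p => p.1 == p.2) (odot A B) -> chain (odot A B).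
Proof.
move=> cAB nd; apply/andP; split; last by rewrite all_predC.
apply: (@pairwise_zip _ _ (fun i j : 'I_n => i < j)%N (fun i j : 'I_n => j < i)%N).
- by rewrite size_rev -!cardE.
- exact: pairwise_enum_set.
- by rewrite pairwise_rev; apply: pairwise_enum_set.
Qed.

Lemma size_odot A B : #|A| = #|B| -> size (odot A B) = #|A|.
Proof. by move=> e; rewrite size_zip size_rev -!cardE e minnn. Qed.

Lemma mem_odot A B x : x \in odot A B -> x.1 \in A /\ x.2 \in B.
Proof.
move=> h; rewrite -(mem_enum A) -(mem_enum B) -(mem_rev (enum B)).
move: h; rewrite /odot; elim: (enum A) (rev _) => [|a s IH] [|b t] //=.
by rewrite !inE => /orP[/eqP ->|/IH[-> ->]]; rewrite ?eqxx ?orbT.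
Qed.

(** The polynomial is the Pfaffian of [lead_chain] for the chain of A and B. The ordinary Pfaffians
    it is built from have index sets containing [S], hence more than the allowed number of indices
    in [j]. *)
Lemma lead_I_ss z (f : ssring K n) : J_ss_gen z f -> f != 0 ->
  exists (g : ssring K n) M M', [/\ I_ss z g, lead g M, f = 'X_[M'] & (M <= M')%MM].
Proof.
move=> [i [j [A [B [ji [/subsetP Ai /subsetP Bj] cA cB ->]]]]] f0.
have cAB : #|A| = #|B| by rewrite cA cB.
have nd : ~~ has (fun p => p.1 == p.2) (odot A B).
  by apply: contra f0; rewrite /u_ss => ->.
rewrite (u_ssE nd); have cAB' := chain_odot cAB nd.
have [|L [S [M [ld sf [sz Sj] [oL oS] _]]]] := @lead_chain K n j _ cAB'.
  by apply/allP => x /mem_odot[_ /Bj]; rewrite inE.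
exists (zpf U L S), M, (chain_mon (odot A B)); split=> //; last first.
  apply/mnm_lepP => k; rewrite -(enum_valK k); have [h1 h2] := sf (enum_val k).
  rewrite chain_monE; case: (posnP (M (enum_rank (enum_val k)))) => [-> //|/h2 h].
  by apply: leq_trans h1 _; case: h => ->; rewrite ?orbT.
have zn0 : zpf U L S != 0.
  by apply/eqP => e; case: ld; rewrite e mcoeff0 eqxx.
have uS : uniq S.
  have : uniq (map (@tagl _) L ++ map (@tagr _) S).
    apply: contraNT zn0 => /(pfs_nuniq (zero_block_skew (@genU_skew K n))
      (zero_block_diag (@genU_diag K n))) h.
    by apply/eqP.
  by rewrite cat_uniq map_inj_uniq => [/and3P[_ _]|a b []] //; rewrite map_inj_uniq // => a b [].
have occ e : occurs e (odot A B) -> (e <= i)%N.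
  case/occursP => x /mem_odot[/Ai + /Bj]; rewrite !inE => h1 h2 [->|->] //.
  exact: leq_trans h2 ji.
apply: zpf_in_ideal.
- exact: genU_skew.
- exact: genU_diag.
- exact: ideal_gen0.
- by move=> a b; apply: ideal_genB.
- by move=> a b; apply: ideal_genM.
move=> W SW WLS; case: (boolP (uniq W)) => uW; last first.
  by rewrite pfs_nuniq //; [apply: ideal_gen0 | apply: genU_skew | apply: genU_diag].
case: (boolP (odd (size W))) => oW; first by rewrite pfs_odd //; apply: ideal_gen0.
pose R := [set x in W].
have cR : #|R| = size W by rewrite cardsE; apply/card_uniqP.
have pR : perm_eq W (enum R).
  by apply: uniq_perm; rewrite ?enum_uniq // => x; rewrite mem_enum inE.
have [b ->] := pfs_perm (@genU_skew K n) (@genU_diag K n) pR.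
have SR : (size S <= #|R :&: [set a : 'I_n | (a <= j)%N]|)%N.
  rewrite -(card_uniqP uS); apply: subset_leq_card; apply/subsetP => e eS.
  by rewrite !inE SW ?Sj.
apply/ideal_genM/ideal_gen_mem; exists R; split.
- apply/eqP => R0; move: SR; rewrite R0 set0I cards0 leqn0 => /eqP S0.
  by move: sz; rewrite S0 size_odot // cA.
- by rewrite cR.
- exists i, j; split=> //; last first.
    by apply: leq_trans SR; rewrite -cA -(size_odot cAB).
  apply/subsetP => e; rewrite !inE => /WLS; rewrite mem_cat => /orP[/oL|/oS]; exact: occ.
- by rewrite pf_principal_sub.
Qed.

(** An antichain that violates a rank bound, cut to rank + 1 cells and sorted by rows, is the list
    [odot A B] of its row set A and column set B, and its monomial divides m. *)
Lemma bad_mon_J_ss z m : involutive z -> ~~ good z m -> J_ss z ('X_[m] : ssring K n).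
Proof.
move=> zK /badP[p [q [C [[pn qn] CD aC rC]]]].
(* Generators of J need j <= i; otherwise the whole picture is transposed. *)
wlog qp : p q C pn qn CD aC rC / (q <= p)%N.
  move=> W; case: (leqP q p) => [|/ltnW] h; first exact: (W p q C).
  apply: (W q p (@swap n @: C)) => //.
  - apply/subsetP => _ /imsetP[x xC ->]; move/subsetP: CD => /(_ x xC).
    rewrite !in_box => /and3P[h1 h2 h3]; rewrite h2 h3 !andbT.
    by rewrite -(supp_sym m) imset_f.
  - move/antichainP: aC => aC; apply/antichainP => _ _ /imsetP[x xC ->] /imsetP[y yC ->] xy.
    by congr swap; apply: aC => //; move: xy; rewrite /ple andbC.
  - by rewrite card_imset; [rewrite rank_perm_sym | exact: can_inj (@swapK n)].
have [x xC] : exists x, x \in C by apply/card_gt0P; apply: leq_ltn_trans rC.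
have := subsetP CD x xC; rewrite in_box => /and3P[_ xp xq].
(* The ordinal for a box side p is p - 1; the sides are positive because [C] has a cell. *)
have p0 : (p.-1 < n)%N by apply: leq_trans pn; rewrite prednK // (leq_ltn_trans _ xp).
have q0 : (q.-1 < n)%N by apply: leq_trans qn; rewrite prednK // (leq_ltn_trans _ xq).
have pE : p.-1.+1 = p by rewrite prednK // (leq_ltn_trans _ xp).
have qE : q.-1.+1 = q by rewrite prednK // (leq_ltn_trans _ xq).
pose r := rank_perm z p q.
pose le1 := fun x y : 'I_n * 'I_n => (x.1 <= y.1)%N.
pose ps := take r.+1 (sort le1 (enum C)).
have psC y : y \in ps -> y \in C.
  by move/mem_take; rewrite mem_sort mem_enum.
have sps : size ps = r.+1 by rewrite size_takel // size_sort -cardE.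
have pps : pairwise (@antidiag n) ps.
  have : pairwise le1 ps && uniq ps.
    rewrite (subseq_pairwise (take_subseq _ _)) /=; last first.
      by rewrite -sorted_pairwise; [apply: sort_sorted => a b; apply: leq_total
        | move=> a b c; apply: leq_trans].
    by rewrite take_uniq // sort_uniq enum_uniq.
  rewrite uniq_pairwise -pairwise_relI.
  apply: (@sub_in_pairwise _ (mem ps)); last by apply/allP.
  move=> a b /psC aa /psC bb /= /andP[ab ne]; move/antichainP: aC => aC.
  rewrite /antidiag; case: (leqP a.2 b.2) => h2.
    by case/eqP: ne; apply: aC => //; apply/andP.
  rewrite andbT ltnNge; apply/negP => ba; case/eqP: ne; apply/esym/aC => //.
  by rewrite /ple ba ltnW.
pose A := [set a in unzip1 ps]; pose B := [set b in unzip2 ps].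
have eA : enum A = unzip1 ps.
  apply: (inj_map val_inj); apply: (irr_sorted_eq ltn_trans ltnn).
  - exact: sorted_enum_set.
  - rewrite sorted_pairwise; last exact: ltn_trans.
    by rewrite !pairwise_map; apply: sub_pairwise pps => a b /andP[].
  - by apply: eq_mem_map => a; rewrite mem_enum inE.
have eB : rev (enum B) = unzip2 ps.
  apply: (canLR revK); apply: (inj_map val_inj); apply: (irr_sorted_eq ltn_trans ltnn).
  - exact: sorted_enum_set.
  - rewrite sorted_pairwise; last exact: ltn_trans.
    rewrite pairwise_map pairwise_rev pairwise_map.
    by apply: sub_pairwise pps => a b /andP[].
  - by apply: eq_mem_map => a; rewrite mem_rev mem_enum inE.
have od : odot A B = ps by rewrite /odot eA eB zip_unzip.
have nd : ~~ has (fun p => p.1 == p.2) (odot A B).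
  rewrite od; apply/hasPn => y /psC /(subsetP CD); rewrite in_box => /and3P[h _ _].
  exact: supp_offdiag h.
have le : (chain_mon ps <= m)%MM.
  apply/mnm_lepP => k; rewrite -(enum_valK k) chain_monE.
  case: (boolP (_ || _)) => // h; rewrite lt0n -lt0n.
  have : val (enum_val k) \in supp m.
    case/orP: h => /psC /(subsetP CD); rewrite in_box => /and3P[// h _ _].
    by rewrite -(supp_sym m) -[val _](@swapK n) imset_f.
  case/suppP => v v0 [e|e]; first by rewrite (val_inj e).
  have := valP (enum_val k); have := valP v; rewrite -e /=; lia.
rewrite -(submK le) mpolyXD; apply/ideal_genM/ideal_gen_mem.
exists (Ordinal p0), (Ordinal q0), A, B; split=> /=.
- by rewrite -ltnS pE qE.
- split; apply/subsetP => e; rewrite !inE => /mapP[y /psC /(subsetP CD)];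
  rewrite in_box => /and3P[_ h1 h2] ->.
    by rewrite -ltnS pE.
  by rewrite -ltnS qE.
- by rewrite cardE eA size_map sps pE qE.
- by rewrite cardE -size_rev eB size_map sps pE qE.
- by rewrite u_ssE // od.
Qed.

End ChainMonomials.

(** * Vanishing on matrix Schubert varieties and on orbits *)

Section Vanishing.

Variables (K : closedFieldType) (n : nat).
Implicit Types (A : 'M[K]_n) (z : nat -> nat).

Lemma eval_ssB (f g : ssring K n) A : eval_ss (f - g) A = eval_ss f A - eval_ss g A.
Proof. exact: mevalB. Qed.

Lemma eval_ssM (f g : ssring K n) A : eval_ss (f * g) A = eval_ss f A * eval_ss g A.
Proof. exact: mevalM. Qed.

Lemma eval_ssX (p : lowpair n) A :
  eval_ss ('X_(enum_rank p) : ssring K n) A = A (val p).1 (val p).2.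
Proof. by rewrite /eval_ss mevalXU enum_rankK. Qed.

Lemma eval_genU A i j : Mat_ss A -> eval_ss (genU K i j) A = A i j.
Proof.
case=> sk dg; case: (ltngtP i j) => [ij|ji|/val_inj ->].
- have [p pE] := lowpair_exists ij; have [_ ->] := genU_low K pE.
  by rewrite /eval_ss mevalN mevalXU enum_rankK pE /= -sk.
- have [p pE] := lowpair_exists ji; have [-> _] := genU_low K pE.
  by rewrite eval_ssX pE.
- by rewrite genU_diag dg /eval_ss meval0.
Qed.

Lemma row_dependence k l (M : 'M[K]_(k, l)) : (\rank M < k)%N ->
  exists2 v : 'rV[K]_k, v != 0 & v *m M = 0.
Proof.
move=> rk; have : kermx M != 0 by rewrite kermx_eq0 /row_free neq_ltn rk.
case/rowV0Pn => v /sub_kermxP h v0; by exists v.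
Qed.

Lemma I_ss_vanishes z (f : ssring K n) : I_ss z f -> vanishing_ideal (X_ss z) f.
Proof.
move=> [s [sI ->]] A XA.
rewrite /eval_ss raddf_sum big_seq big1 // => -[c0 f0] /sI /= [R [_ _ [i [j [ji /subsetP Ri rk]]] ->]].
rewrite -[LHS]/(eval_ss _ A) eval_ssM.
case: XA => As /(_ i j) rkA; have [sk _] := As.
rewrite [X in _ * X = _](_ : _ = 0) ?mulr0 //.
rewrite /eval_ss pf_principal_sub (rmorph_pfs _ (meval _)).
rewrite (@eq_pfs _ _ _ (fun x y => A x y)); last by move=> x y _ _; apply: eval_genU.
set R' := R :&: _ in rk.
have inj (l : 'I_#|R'|) : (enum_val l < j.+1)%N.
  by have := enum_valP l; rewrite !inE => /andP[].
pose g l := Ordinal (inj l).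
pose M := rowsub g (ulsub A i j)^T.
have [|v v0 vM] := @row_dependence _ _ M.
  apply: leq_ltn_trans rk; apply: leq_trans rkA; rewrite -[X in (_ <= X)%N]mxrank_tr.
  by apply: mxrankS; apply: rowsub_sub.
have [l0 vl0] : exists l, v 0 l != 0.
  apply/existsP; apply: contraNT v0 => /existsPn H; apply/eqP/rowP => l.
  by rewrite mxE; apply/eqP; have := H l; rewrite negbK.
(* The dependence between the rows in R meet [j], extended by zero, is a left kernel vector of the
   principal submatrix on R. *)
pose c x := \sum_l v 0 l * (enum_val l == x)%:R.
have cE : c (enum_val l0) = v 0 l0.
  rewrite /c (bigD1 l0) //= eqxx mulr1 big1 ?addr0 // => l ne.
  by rewrite (inj_eq enum_val_inj) (negbTE ne) mulr0.
apply: (@pfs_lker _ _ _ _ _ _ c (enum_val l0)).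
- by move=> x y; apply: sk.
- by case: As.
- by rewrite mem_enum; have := enum_valP l0; rewrite inE => /andP[].
- exact: enum_uniq.
- by rewrite cE; apply/lregP.
move=> y; rewrite mem_enum => yR; have := Ri y yR; rewrite inE => yi.
have /rowP/(_ (Ordinal (n := i.+1) yi)) := vM; rewrite !mxE => vMy.
under eq_bigr do rewrite /c mulr_suml.
rewrite exchange_big /= -[RHS]oppr0 -[in RHS]vMy -sumrN; apply: eq_bigr => l _.
have lR : enum_val l \in enum R.
  by rewrite mem_enum; have := enum_valP l; rewrite inE => /andP[].
rewrite (bigD1_seq (enum_val l)) ?enum_uniq //= eqxx mulr1 big1 ?addr0; last first.
  by move=> x; rewrite eq_sym => /negbTE ->; rewrite mulr0 mul0r.
rewrite !mxE sk mulrN; congr (- (_ * A _ _)); exact/val_inj.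
Qed.

End Vanishing.

(** * Orbits and their degenerations *)

Section OrbitForm.

Variable K : comNzRingType.
Implicit Types (b : nat -> nat -> K) (z : nat -> nat).

(** The diagonal is arbitrary, so these [b] form an affine space and lines in it can be used to
    propagate vanishing. *)
Definition lower b := forall p a, (p < a)%N -> b p a = 0.

Definition minor2 b (p q a c : nat) : K := b p a * b q c - b p c * b q a.

(* The entries of [b Z b^T], where [Z] is the skew-symmetric signed permutation *)
(* matrix of [z].                                                               *)
Definition orb z (N : nat) b (p q : nat) : K :=
  \sum_(0 <= a < N) if (z a < a)%N then minor2 b p q a (z a) else 0.

Lemma orb_skew z N b p q : orb z N b p q = - orb z N b q p.
Proof.
rewrite /orb -sumrN; apply: eq_bigr => a _; case: ifP => _; last by rewrite oppr0.
by rewrite /minor2; ring.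
Qed.

Lemma orb_diag z N b p : orb z N b p p = 0.
Proof.
rewrite /orb big1 // => a _; case: ifP => // _; rewrite /minor2.
by rewrite [b p (z a) * _]mulrC subrr.
Qed.

Lemma orb_range z N N' b p q : lower b -> (p < N)%N -> (q < N)%N -> (N <= N')%N ->
  orb z N b p q = orb z N' b p q.
Proof.
move=> lb pN qN NN; rewrite /orb (big_cat_nat (n := N) (p := N')) //=.
rewrite [X in _ + X]big1_seq ?addr0 // => a /andP[_]; rewrite mem_index_iota.
move=> /andP[Na _]; case: ifP => // _.
by rewrite /minor2 !(lb _ a) ?mul0r ?mulr0 ?subrr // (leq_trans _ Na).
Qed.

End OrbitForm.

Section Orbit.

Variable K : closedFieldType.
Implicit Types (b : nat -> nat -> K) (z : nat -> nat).

Section OneInvolution.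

Variable z : nat -> nat.
Hypothesis zK : involutive z.
Hypothesis z_fpf : forall a, z a != a.

(** Both orientations of each pair are gathered in one signed sum, whose surviving terms are the
    dots counted by [rank_perm z i j]. This gives the rank bound of [orb_X_ss], by factoring through
    these dots. *)
Lemma orb_sum N b (p q i j : nat) : lower b -> (p < i)%N -> (q < j)%N ->
  (i <= N)%N -> (j <= N)%N ->
  orb z N b p q = \sum_(0 <= a < i | (z a < j)%N)
     (-1) ^+ (a < z a)%N * (b p a * b q (z a)).
Proof.
move=> lb pi qj iN jN.
have sumz (F : nat -> K) : \sum_(0 <= a < N | (z a < N)%N) F (z a) =
    \sum_(0 <= a < N | (z a < N)%N) F a.
  rewrite !big_mkord.
  (* [z] made into an involution of ['I_N]: indices whose image falls outside are fixed. *)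
  pose h (a : 'I_N) : 'I_N := odflt a (insub (z a)).
  have hE (a : 'I_N) : (z a < N)%N -> h a = z a :> nat.
    by rewrite /h => zaN; rewrite insubT.
  have hn (a : 'I_N) : ~~ (z a < N)%N -> h a = a by move=> zaN; rewrite /h insubN.
  have hK : involutive h.
    move=> a; case: (boolP (z a < N)%N) => za; last by rewrite !hn.
    by apply: val_inj; rewrite /= hE hE ?zK.
  rewrite [RHS](reindex_inj (can_inj hK)) /=.
  apply: eq_big => [a|a za]; last by rewrite hE.
  case: (boolP (z a < N)%N) => za; first by rewrite hE // zK ltn_ord.
  by rewrite hn // (negbTE za).
have -> : \sum_(0 <= a < i | (z a < j)%N) (-1) ^+ (a < z a)%N * (b p a * b q (z a)) =
    \sum_(0 <= a < N | (z a < N)%N) (-1) ^+ (a < z a)%N * (b p a * b q (z a)).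
  rewrite [RHS](big_cat_nat (n := i)) //= [X in _ = _ + X]big1_seq ?addr0; last first.
    move=> a /andP[_]; rewrite mem_index_iota => /andP[ia _].
    by rewrite (lb p a) ?mul0r ?mulr0 // (leq_trans pi ia).
  rewrite big_mkcond [RHS]big_mkcond /=; apply: eq_bigr => a _.
  case: (ltnP (z a) j) => zj; first by rewrite (leq_trans zj jN).
  by case: ifP => // _; rewrite (lb q (z a)) ?mulr0 // (leq_trans qj zj).
have split : \sum_(0 <= a < N | (z a < N)%N) (-1) ^+ (a < z a)%N * (b p a * b q (z a)) =
    \sum_(0 <= a < N | (z a < N)%N) (if (z a < a)%N then b p a * b q (z a) else 0) -
    \sum_(0 <= a < N | (z a < N)%N) (if (a < z a)%N then b p a * b q (z a) else 0).
  rewrite -sumrB; apply: eq_bigr => a _; have := z_fpf a.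
  by case: (ltngtP a (z a)) => //= _ _; rewrite ?mulN1r ?mul1r ?sub0r ?subr0.
rewrite split -(sumz (fun a => if (a < z a)%N then _ else 0)) -sumrB.
rewrite [RHS]big_mkcond; apply: eq_big_nat => a /andP[_ aN] /=.
rewrite zK; case: (ltnP (z a) a) => za; last by rewrite subr0 if_same.
by rewrite (ltn_trans za aN) /minor2 [b p (z a) * _]mulrC [b q a * _]mulrC.
Qed.

Lemma orb_lowest N b (i j : nat) : lower b -> (i < N)%N -> (j < N)%N ->
  rank_perm z i.+1 j.+1 = 0%N -> orb z N b i j = 0.
Proof.
move=> lb iN jN r0; rewrite (orb_sum lb (ltnSn i) (ltnSn j) iN jN) big_mkcond big1_seq //.
move=> a; rewrite mem_index_iota => /andP[_ /andP[_ ai]]; case: ifP => // zaj.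
by have := rank_perm_gt0 ai zaj; rewrite r0.
Qed.

Lemma orb_X_ss n b : lower b -> X_ss z (\matrix_(p < n, q < n) orb z n b p q).
Proof.
move=> lb; split.
  by split=> [p q|p]; rewrite !mxE; [apply: orb_skew | apply: orb_diag].
move=> i j; pose T := [set a : 'I_i.+1 | (z a < j.+1)%N].
pose L := \matrix_(p < i.+1, k < #|T|) b p (enum_val k).
pose R := \matrix_(k < #|T|, q < j.+1)
  ((-1) ^+ (enum_val k < z (enum_val k))%N * b q (z (enum_val k))).
rewrite (_ : ulsub _ i j = L *m R); first exact: mulmx_max_rank.
apply/matrixP => p q; rewrite !mxE /=.
rewrite (orb_sum lb (ltn_ord p) (ltn_ord q) (ltn_ord i) (ltn_ord j)) big_mkord.
rewrite [LHS](eq_bigl (fun a => a \in T)) => [|a]; last by rewrite inE.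
rewrite big_enum_val; apply: eq_bigr => k _; rewrite !mxE.
by rewrite mulrCA.
Qed.

End OneInvolution.

(* The substitution e_i -> t e_i + e_i', e_j -> e_j + c e_j', e_i' -> -+ c e_i' *)
(* with c = +- 1 / t, chosen so that the terms in e_i' e_j' cancel and the form *)
(* of z tends to that of [swap_pair z i i'] as t tends to 0.                    *)
Definition degen z (t : K) (i i' : nat) b (p a : nat) : K :=
  let j := z i in let j' := z i' in
  let e1 : K := (-1) ^+ (i < j')%N in let e2 : K := (-1) ^+ (i' < j')%N in
  if a == i then t * b p i + b p i'
  else if a == j then b p j + e1 / t * b p j'
  else if a == i' then - (e1 * e2 / t) * b p i'
  else b p a.

Lemma lower_degen z t i i' b : (i < i')%N -> (z i < z i')%N -> lower b ->
  lower (degen z t i i' b).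
Proof.
move=> ii jj lb p a pa; rewrite /degen.
case: eqP => [e|_]; first by rewrite !lb ?mulr0 ?addr0 -?e // (ltn_trans pa) ?e.
case: eqP => [e|_]; first by rewrite !lb ?mulr0 ?addr0 -?e // (ltn_trans pa) ?e.
by case: eqP => [e|_]; rewrite lb ?mulr0 -?e.
Qed.

(** Besides the form of z' only one term, linear in t, remains; both sides agree exactly, so t = 0
    can be reached by polynomial continuation. *)
Lemma orb_degen z t (i i' N : nat) b (p q : nat) :
  involutive z -> (forall a, z a != a) ->
  (z i < i)%N -> (i < i')%N -> (z i < z i')%N ->
  (maxn i' (z i') < N)%N -> t != 0 ->
  orb z N (degen z t i i' b) p q =
  orb (swap_pair z i i') N b p q + t * minor2 b p q i (z i).
Proof.
move=> zK zf lzi li lz Nb t0.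
have [u [v1 v2 v3 v4] v5] := swap_pairE zK zf lzi li lz.
have aN : all (fun a => a < N)%N [:: i; i'; z i; z i'].
  by rewrite /= !andbT; move: Nb; rewrite gtn_max => /andP[h1 h2]; lia.
rewrite /orb !(sum_nat_split _ u aN) addrAC; congr (_ + _); last first.
  apply: eq_bigr => a na; rewrite v5 //; case: ifP => // _.
  have E c : c \notin [:: i; i'; z i; z i'] -> forall r, degen z t i i' b r c = b r c.
    rewrite !inE !negb_or => /and4P[/negbTE e1 /negbTE e2 /negbTE e3 _] r.
    by rewrite /degen e1 e2 e3.
  have na' : z a \notin [:: i; i'; z i; z i'].
    apply: contra na; rewrite !inE -!(can2_eq zK zK) ?zK.
    by case/or4P => ->; rewrite ?orbT.
  by rewrite /minor2 !E.
rewrite !big_cons !big_nil v1 v2 v3 v4 !zK lzi.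
have -> : (i < z i)%N = false by lia.
have -> : (i' < z i)%N = false by lia.
have -> : (z i < i')%N by lia.
have Ei r : degen z t i i' b r i = t * b r i + b r i' by rewrite /degen eqxx.
have Ej r : degen z t i i' b r (z i) = b r (z i) + (-1) ^+ (i < z i')%N / t * b r (z i').
  by rewrite /degen eqxx; have -> : z i == i = false by lia.
have Ei' r : degen z t i i' b r i' =
    - ((-1) ^+ (i < z i')%N * (-1) ^+ (i' < z i')%N / t) * b r i'.
  rewrite /degen eqxx; have -> : i' == i = false by lia.
  by have -> : i' == z i = false by lia.
have Ej' r : degen z t i i' b r (z i') = b r (z i').
  move: u; rewrite /= !inE !negb_or /degen => /and4P[/and3P[_ _ e1] /andP[_ e2] e3 _].
  by rewrite eq_sym (negbTE e1) eq_sym (negbTE e3) eq_sym (negbTE e2).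
rewrite /minor2 !Ei !Ej !Ei' !Ej'.
have := zf i'; have : z i' != i.
  by apply/eqP => e; move: lz; rewrite -e zK; lia.
(* The orientation of the new pairs, and with it the signs in [degen], depends on the position of z
   i' relative to i and i'. *)
by case: (ltngtP (z i') i) => // _ _; case: (ltngtP (z i') i') => // _ _;
  rewrite /= ?expr0 ?expr1; field.
Qed.

End Orbit.

(** * Initial ideals *)

Section InitialIdeal.

Variables (K : closedFieldType) (n : nat).
Implicit Types (z : nat -> nat) (m M : 'X_{1..nvars n}) (f g : ssring K n).

(** Otherwise h X + 1 would be nonconstant, hence have a root, where its value is 1. *)
Lemma poly_eq0_horner (h : {poly K}) : (forall t, h.[t] = 0) -> h = 0.
Proof.
move=> h0; apply/eqP; apply: contraT => hn0.
have : size (h * 'X + 1) != 1%N.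
  by rewrite -[1]/(1%:P) size_MXaddC (negbTE hn0) /= eqSS size_poly_eq0.
case/closed_rootP => t; rewrite rootE hornerD hornerM h0 mul0r hornerC add0r.
by rewrite oner_eq0.
Qed.

Lemma meval_horner f (v : 'I_(nvars n) -> {poly K}) :
  exists h : {poly K}, forall t, h.[t] = f.@[fun k => (v k).[t]].
Proof.
exists (\sum_(m <- msupp f) f@_m *: \prod_k v k ^+ m k) => t.
rewrite mevalE horner_sum; apply: eq_bigr => m _.
rewrite hornerZ horner_prod; congr (_ * _); apply: eq_bigr => k _.
by rewrite horner_exp.
Qed.

Definition orbit_mx z (b : nat -> nat -> K) : 'M[K]_n :=
  \matrix_(p < n, q < n) orb z n b p q.

Definition vanishes_on_orbit z f : Prop :=
  forall b, lower b -> eval_ss f (orbit_mx z b) = 0.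

Lemma horner_orb z N (B : nat -> nat -> {poly K}) p q t :
  (orb z N B p q).[t] = orb z N (fun p a => (B p a).[t]) p q.
Proof.
rewrite /orb horner_sum; apply: eq_bigr => a _; case: ifP; rewrite ?horner0 //.
by rewrite /minor2 hornerD hornerN !hornerM.
Qed.

Section Step.

Variables (z : nat -> nat) (zK : involutive z) (z_fpf : forall a, z a != a).
Variables (v : lowpair n).
Let i := (val v).1.
Let j := (val v).2.
Hypothesis zij : z i = j.

(** Along the line from the identity (t = 0) to b (t = 1) both factors are polynomials in t. The
    entry (i, j) is 1 at the identity, so the other factor is the zero polynomial, in particular at
    t = 1. *)
Lemma vanishes_cancel g : vanishes_on_orbit z ('X_(enum_rank v) * g) ->
  vanishes_on_orbit z g.
Proof.
move=> van b lb; pose d p a : K := ((p == a :> nat) : nat)%:R.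
pose B p a : {poly K} := (d p a)%:P + (b p a - d p a) *: 'X.
pose bt t p a := (B p a).[t].
have lbt t : lower (bt t).
  move=> p a pa; rewrite /bt /B lb // /d ltn_eqF //.
  by rewrite subrr scale0r addr0 hornerC.
have [h hE] := meval_horner g (fun k => orb z n B (val (enum_val k)).1 (val (enum_val k)).2).
have hE' t : h.[t] = eval_ss g (orbit_mx z (bt t)).
  by rewrite hE /eval_ss; apply: meval_eq => k; rewrite horner_orb mxE.
have : orb z n B i j * h = 0.
  apply: poly_eq0_horner => t; rewrite hornerM horner_orb hE'.
  by have := van (bt t) (lbt t); rewrite eval_ssM eval_ssX mxE.
move/eqP; rewrite mulf_eq0 => /orP[/eqP /(congr1 (fun p => p.[0]))|/eqP h0].
  rewrite horner_orb horner0 (orb_sum zK z_fpf (i := i.+1) (j := j.+1)) //.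
  rewrite big_mkcond big_nat_recr //= zij ltnSn ltnNge (ltnW (valP v)) expr0 mul1r.
  rewrite big1_seq ?add0r => [|a].
    by rewrite /B /d !hornerE !eqxx mulr1 => /eqP; rewrite oner_eq0.
    rewrite mem_index_iota => /andP[_ /andP[_ ai]]; case: ifP => // _.
    rewrite /B /d !hornerE [(i == a :> nat)]eq_sym (ltn_eqF ai) /=.
    by rewrite mulr0 mul0r.
  exact: (lbt 0).
have := hE' 1; rewrite h0 horner0 => /esym.
rewrite /eval_ss => <-; apply: meval_eq => k; rewrite !mxE; apply: eq_bigr => a _.
have E p c : bt 1 p c = b p c.
  by rewrite /bt hornerD hornerC hornerZ hornerX mulr1 addrC subrK.
by rewrite /minor2 !E.
Qed.

Lemma vanishes_swap_pair g i' : (i < i')%N -> (j < z i')%N ->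
  vanishes_on_orbit z g -> vanishes_on_orbit (swap_pair z i i') g.
Proof.
(* The indices i' and z i' may lie outside [n], so the form is computed with a larger truncation;
   [orb_range] makes the difference invisible. *)
move=> ii jj van b lb; pose N := (maxn (maxn i' (z i')) n).+1.
pose B p q : {poly K} := (orb (swap_pair z i i') N b p q)%:P + minor2 b p q i j *: 'X.
have [h hE] := meval_horner g (fun k => B (val (enum_val k)).1 (val (enum_val k)).2).
have nN : (n <= N)%N by rewrite ltnW // ltnS leq_maxr.
(* The degeneration exists only for nonzero t; the factor X takes care of t = 0. *)
have h0 : h * 'X = 0.
  apply: poly_eq0_horner => t; rewrite hornerM hornerX.
  case: (eqVneq t 0) => [->|t0]; first by rewrite mulr0.
  have lzi : (z i < i)%N by rewrite zij; apply: (valP v).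
  have jj' : (z i < z i')%N by rewrite zij.
  have lb' := lower_degen t ii jj' lb.
  rewrite hE -[RHS](mul0r t) -[in RHS](van _ lb') /eval_ss; congr (_ * _).
  apply: meval_eq => k; rewrite mxE (orb_range z lb' (ltn_ord _) (ltn_ord _) nN).
  rewrite (@orb_degen _ z t i i' N b _ _ zK z_fpf lzi ii jj') ?ltnS ?leq_maxl //.
  by rewrite /B !hornerE zij mulrC.
move/eqP: h0; rewrite mulf_eq0 polyX_eq0 orbF => /eqP h0.
have := hE 0; rewrite h0 horner0 /eval_ss => ->; apply: meval_eq => k.
by rewrite mxE /B hornerD hornerC hornerZ hornerX mulr0 addr0 (orb_range _ lb _ _ nN).
Qed.

End Step.

(** Each monomial of f is a multiple of a generator of J, thus of a leading monomial from
    [lead_I_ss]; multiplying by the cofactor preserves leadership. *)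
Lemma J_ss_lead z f m : J_ss z f -> m \in msupp f ->
  exists2 g : ssring K n, I_ss z g & lead g m.
Proof.
move=> [s [sJ ->]] ms.
have [c cs mc] : exists2 c, c \in s & m \in msupp (c.1 * c.2).
  elim: s ms {sJ} => [|c s IH]; first by rewrite big_nil msupp0.
  rewrite big_cons => /msuppD_le; rewrite mem_cat => /orP[h|/IH[c' cs h]].
    by exists c; rewrite ?mem_head.
  by exists c'; rewrite // inE cs orbT.
have c2 : c.2 != 0 by apply: contraTneq mc => ->; rewrite mulr0 msupp0.
have [g [M [M' [Ig ld c2E le]]]] := lead_I_ss (sJ c cs) c2.
move/msuppM_le: mc => /allpairsP[[m1 m2] /= [_ + ->]]; rewrite c2E msuppX inE => /eqP ->.
exists (g * 'X_[m1 + (M' - M)]); first by rewrite mulrC; apply: ideal_genM.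
have -> : (m1 + M' = M + (m1 + (M' - M)))%MM.
  by rewrite [RHS]addmC -addmA submK.
exact: leadMX.
Qed.

Lemma msupp_sum_mon (s : seq 'X_{1..nvars n}) (P : pred 'X_{1..nvars n})
    (c : 'X_{1..nvars n} -> K) (F : 'X_{1..nvars n} -> 'X_{1..nvars n}) m :
  m \in msupp (\sum_(a <- s | P a) c a *: 'X_[F a]) -> exists a, [/\ a \in s, P a & m = F a].
Proof.
elim: s => [|a s IH]; first by rewrite big_nil msupp0.
rewrite big_cons; case: ifP => Pa; last by case/IH => a' [h1 h2 h3]; exists a'; rewrite inE h1 orbT.
move/msuppD_le; rewrite mem_cat => /orP[/msuppZ_le|/IH[a' [h1 h2 h3]]].
  by rewrite msuppX inE => /eqP ->; exists a; rewrite mem_head.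
by exists a'; rewrite inE h1 orbT.
Qed.

Definition rank_sum z : nat :=
  (\sum_(p < n.+1) \sum_(q < n.+1) rank_perm z p q)%N.

(** The rank drops strictly at (i + 1, z i + 1), which lies in the summation range. *)
Lemma rank_sum_swap z i i' : involutive z -> (forall a, z a != a) ->
  (i < n)%N -> (z i < i)%N -> (i < i')%N -> (z i < z i')%N ->
  (rank_sum (swap_pair z i i') < rank_sum z)%N.
Proof.
move=> zK zf iN lzi li lz.
have le p q : (rank_perm (swap_pair z i i') p q <= rank_perm z p q)%N.
  by rewrite (rank_perm_swap zK zf p q lzi li lz) -addnA leq_addr.
have i1 : (i.+1 < n.+1)%N by [].
have j1 : ((z i).+1 < n.+1)%N by rewrite ltnS (ltn_trans lzi).
rewrite /rank_sum (bigD1 (Ordinal i1)) //= [X in (_ < X)%N](bigD1 (Ordinal i1)) //=.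
rewrite -addSn; apply: leq_add; last first.
  by apply: leq_sum => p _; apply: leq_sum => q _.
rewrite (bigD1 (Ordinal j1)) //= [X in (_ < X)%N](bigD1 (Ordinal j1)) //=.
rewrite -addSn; apply: leq_add; last by apply: leq_sum => q _.
rewrite (rank_perm_swap zK zf i.+1 (z i).+1 lzi li lz).
by rewrite ltnSn li ltnSn lz /=; lia.
Qed.

(** Division: the largest bad monomial is cancelled repeatedly. All subtracted terms are below [M],
    so its coefficient survives, and degrees never grow, so [nbelow d] decreases. *)
Lemma reduce_mod_leads z (I : ssring K n -> Prop) d M f :
  (forall g, I g -> forall h c, I h -> I (g - c *: h)) -> I 0 ->
  (forall m, ~~ good z m -> exists2 g, I g & lead g m) ->
  (forall m, m \in msupp f -> (mdeg m < d)%N) ->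
  (forall m, m \in msupp f -> ~~ good z m -> revlex_lt m M) ->
  exists g, [/\ I (f - g), forall m, m \in msupp g -> good z m & g@_M = f@_M].
Proof.
move=> IB I0 ld; pose P k f := forall m, m \in msupp f -> ~~ good z m -> (nbelow d m < k)%N.
have [k Pk] : exists k, P k f.
  exists #|{: bmultinom (nvars n) d}|.+1 => m _ _; rewrite ltnS; exact: max_card.
elim: k f Pk => [|k IH] f Pk fd fM.
  exists f; rewrite subrr; split=> // m mf; apply: contraT => /(Pk m mf).
  by rewrite ltn0.
case: (boolP (has (predC (good z)) (msupp f))) => [/revlex_max|/hasPn H]; last first.
  by exists f; rewrite subrr; split=> // m /H; rewrite negbK.
case=> b [bf bb bmax]; have [h Ih [hb hlt]] := ld b bb.
pose c := f@_b / h@_b; pose f' := f - c *: h.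
have f'b : f'@_b = 0 by rewrite mcoeffB mcoeffZ /c divfK // subrr.
have f'lt m : m \in msupp f' -> ~~ good z m -> revlex_lt m b.
  move=> mf' mb; have mneb : m != b.
    by apply: contraTneq mf' => ->; rewrite mcoeff_msupp f'b eqxx.
  move: mf' => /msuppB_le; rewrite mem_cat => /orP[/bmax|/msuppZ_le/hlt]; exact.
have bM : revlex_lt b M by apply: fM.
have hdeg m : m \in msupp h -> (mdeg m <= mdeg b)%N.
  by move=> mh; case: (eqVneq m b) => [->//|/(hlt m mh)/revlex_mdeg].
have [| | |g [h1 h2 h3]] := IH f'.
- move=> m mf' mb; have := Pk b bf bb; rewrite ltnS; apply: leq_trans.
  apply: nbelow_lt (f'lt m mf' mb).
  move: mf' => /msuppB_le; rewrite mem_cat => /orP[/fd //|/msuppZ_le/hdeg le].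
  exact: leq_ltn_trans le (fd b bf).
- move=> m /msuppB_le; rewrite mem_cat => /orP[/fd //|/msuppZ_le/hdeg le].
  exact: leq_ltn_trans le (fd b bf).
- by move=> m mf' /(f'lt m mf') h0; apply: revlex_trans h0 bM.
exists g; split=> //.
  have -> : f - g = (f' - g) - (- c) *: h.
    by rewrite /f' scaleNr opprK addrAC subrK.
  exact: IB.
rewrite h3 mcoeffB mcoeffZ (@memN_msupp_eq0 _ _ h M) ?mulr0 ?subr0 //.
apply/negP => Mh; case: (eqVneq M b) => [e|/(hlt M Mh) h0].
  by move: bM; rewrite e revlex_irr.
by have := revlex_trans h0 bM; rewrite revlex_irr.
Qed.

Lemma good_rank0 z m : good z m -> rank_perm z n n = 0%N -> m = 0%MM.
Proof.
move=> /goodP gm r0; apply/mnmP => k; rewrite mnmE; apply/eqP.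
rewrite -leqn0 leqNgt; apply/negP; rewrite -(enum_valK k) => mk.
have := gm n n; rewrite r0 leqNgt => /negP; apply.
apply: leq_trans (width_geq (C := [set val (enum_val k)]) _ _).
- by rewrite cards1.
- rewrite sub1set in_box !ltn_ord andbT /= andbT; apply/suppP.
  by exists (enum_val k) => //; left.
- by apply/antichainP => y y' /set1P -> /set1P ->.
Qed.

(** Take the smallest j in [n] whose partner i also lies in [n]; a further dot in the box of (i, j)
    would give a smaller j. *)
Lemma lowest_dot z : involutive z -> (forall a, z a != a) ->
  rank_perm z n n != 0%N ->
  exists v : lowpair n, [/\ z (val v).1 = (val v).2,
    rank_perm z (val v).1 (val v).2.+1 = 0%N & rank_perm z (val v).1.+1 (val v).2 = 0%N].
Proof.
move=> zK zf rn0.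
have ex : exists j, (j < n)%N && (z j < n)%N.
  have : [exists a : 'I_n, (z a < n)%N].
    apply: contraR rn0 => /existsPn H; rewrite rank_permE big1_seq // => a.
    by rewrite mem_index_iota => /andP[_ /andP[_ an]]; have := H (Ordinal an); case: (z a < n)%N.
  by case/existsP => a h; exists a; rewrite ltn_ord.
case: (ex_minnP ex) => j /andP[jn zjn] mn.
have lji : (j < z j)%N.
  by rewrite ltn_neqAle eq_sym zf mn // zjn zK.
have [v vE] := @lowpair_exists n (Ordinal zjn) (Ordinal jn) lji.
exists v; rewrite vE /=; split; first exact: zK.
  rewrite rank_permE big1_seq // => x; rewrite mem_index_iota => /andP[_ /andP[_ xi]].
  apply/eqP; rewrite eqb0 ltnS; apply/negP; rewrite leq_eqVlt => /orP[/eqP e|zxj].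
    by move: xi; rewrite -e zK ltnn.
  have := mn (z x); rewrite zK (ltn_trans zxj jn) (ltn_trans xi zjn) => /(_ isT).
  by rewrite leqNgt zxj.
rewrite rank_permE big1_seq // => x; rewrite mem_index_iota ltnS => /andP[_ /andP[_ xi]].
apply/eqP; rewrite eqb0; apply/negP => zxj.
have := mn (z x); rewrite zK (ltn_trans zxj jn) (leq_ltn_trans xi zjn) => /(_ isT).
by rewrite leqNgt zxj.
Qed.

(** Write f = g0 + u_ij g1 for the lowest dot (i, j), with g0 free of u_ij. The hypothesis on
    smaller involutions gives g0 = 0; then u_ij is cancelled and an induction on the degree bound
    applies to g1. *)
Lemma zero_of_good z f : involutive z -> (forall a, z a != a) ->
  (forall z', involutive z' -> (forall a, z' a != a) -> (rank_sum z' < rank_sum z)%N ->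
     forall g M, vanishes_on_orbit z' g -> lead g M -> ~~ good z' M) ->
  vanishes_on_orbit z f -> (forall m, m \in msupp f -> good z m) -> f = 0.
Proof.
move=> zK zf IH; case: (eqVneq (rank_perm z n n) 0%N) => [r0|rn0] van gf.
  have fC : f = (f@_0%MM)%:MP.
    apply/mpolyP => m; rewrite mcoeffC; case: (eqVneq m 0%MM) => [->|mn0].
      by rewrite mulr1.
    rewrite mulr0; apply: memN_msupp_eq0; apply: contra mn0 => /gf gm.
    by apply/eqP; apply: good_rank0 gm r0.
  (* With b = 0 the zero matrix is a point of the orbit, so evaluation there kills the constant
     f. *)
  have l0 : lower (fun _ _ : nat => 0 : K) by [].
  by have := van _ l0; rewrite fC /eval_ss mevalC => ->; rewrite mpolyC0.
have [v [zv r1 r2]] := lowest_dot zK zf rn0.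
pose k0 := enum_rank v.
have [k fk] : exists k, forall m, m \in msupp f -> (mdeg m < k)%N.
  by exists (msize f) => m; apply: msize_mdeg_lt.
elim: k f fk van gf => [|k IHk] f fk van gf.
  by apply: msuppnil0; case: (msupp f) fk => // m s /(_ m); rewrite mem_head => /(_ isT).
pose g0 := \sum_(m <- msupp f | m k0 == 0%N) f@_m *: 'X_[m].
pose g1 := \sum_(m <- msupp f | m k0 != 0%N) f@_m *: 'X_[m - U_(k0)].
have fE : f = g0 + 'X_k0 * g1.
  rewrite {1}(mpolyE f) (bigID (fun m : 'X_{1..nvars n} => m k0 == 0%N)) /=; congr (_ + _).
  rewrite mulr_sumr; apply: eq_bigr => m mk.
  by rewrite -scalerAr -mpolyXD addmC submK // lep1mP.
have g0E m : m \in msupp g0 -> m k0 = 0%N /\ good z m.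
  by move=> /(msupp_sum_mon (F := id))[a [/gf h1 /eqP h2 ->]].
have g1E m : m \in msupp g1 -> (m + U_(k0))%MM \in msupp f.
  by move=> /msupp_sum_mon[a [h1 h2 ->]]; rewrite submK // lep1mP.
have g00 : g0 = 0.
  apply/eqP; apply: contraT => /lead_exists[M [M1 M2]].
  have [Mk gM] : M k0 = 0%N /\ good z M by apply: g0E; rewrite mcoeff_msupp.
  have nij : ((val v).1, (val v).2) \notin supp M.
    apply/negP => /suppP[p Mp]; rewrite /swap -surjective_pairing => -[e|e].
      by move: Mp; rewrite -(val_inj e) -/k0 Mk.
    by have := valP v; have := valP p; rewrite -e /=; lia.
  have [i' [ii jj gM']] := good_swap_pair zK zf zv (valP v) r1 r2 nij gM.
  have lzi : (z (val v).1 < (val v).1)%N by rewrite zv (valP v).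
  have jj' : (z (val v).1 < z i')%N by rewrite zv.
  have := IH (swap_pair z (val v).1 i') (swap_pairK zK _ _) (swap_pair_fpf zf _ _)
    (rank_sum_swap zK zf (ltn_ord _) lzi ii jj') g0 M.
  rewrite gM' => H; apply: H => // b lb.
  (* On the orbit of z', f vanishes by degeneration and u_ij because the rank of z' at (i + 1, j +
     1) is zero. So g0 vanishes there, although its leading monomial is good for z'. *)
  have -> : g0 = f - 'X_k0 * g1 by rewrite {1}fE addrK.
  rewrite eval_ssB (vanishes_swap_pair zK zf zv ii jj van lb) eval_ssM eval_ssX mxE.
  rewrite (orb_lowest (swap_pairK zK _ _) (swap_pair_fpf zf _ _) lb) ?ltn_ord ?mul0r ?subr0 //.
  have := rank_perm_swap zK zf (val v).1.+1 (val v).2.+1 lzi ii jj'.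
  rewrite rank_permSl r1 zv ltnSn ii ltnSn jj /=; lia.
have vX : vanishes_on_orbit z ('X_k0 * g1) by move: van; rewrite {1}fE g00 add0r.
suff g10 : g1 = 0 by rewrite fE g00 g10 mulr0 addr0.
apply: IHk.
- by move=> m /g1E /fk; rewrite mdegD mdeg1 addn1 ltnS.
- exact: (vanishes_cancel zK zf zv vX).
- by move=> m /g1E /gf; apply: good_mono; apply: lem_addr.
Qed.

(** If M were good, every bad monomial of f would be below M, and division by elements of [I_ss],
    which vanish on the orbit, would leave a nonzero remainder with good monomials only. *)
Lemma lead_bad z f M : involutive z -> (forall a, z a != a) ->
  vanishes_on_orbit z f -> lead f M -> ~~ good z M.
Proof.
have [k] := ubnP (rank_sum z); elim: k z f M => // k IH z f M sk zK zf van [fM flt].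
apply/negP => gM.
have [||m mz|m mf|m mf mb|g [h1 h2 h3]] :=
  @reduce_mod_leads z (vanishes_on_orbit z) (msize f) M f.
- by move=> g vg h c vh b lb; rewrite eval_ssB -mul_mpolyC eval_ssM vg // vh // mulr0 subrr.
- by move=> b lb; rewrite /eval_ss meval0.
- have Jm := bad_mon_J_ss K zK mz.
  have [|g Ig lg] := @J_ss_lead z 'X_[m] m Jm; first by rewrite msuppX mem_head.
  exists g => // b lb; exact: (I_ss_vanishes Ig) (orb_X_ss zK zf n lb).
- exact: msize_mdeg_lt.
- by apply: flt => //; apply: contraNneq mb => ->.
have g0 : g = 0.
  apply: (@zero_of_good z) => // [z' z'K z'f lt g' M'|b lb].
    by apply: IH => //; apply: leq_trans lt _; rewrite -ltnS.
  have -> : g = f - (f - g) by rewrite opprB addrC subrK.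
  by rewrite eval_ssB van // h1 // subrr.
by move: fM; rewrite -h3 g0 mcoeff0 eqxx.
Qed.

End InitialIdeal.

(** * The extended involution is fixed-point-free *)

Section FPFInvolution.

Variables (n : nat) (y : 'S_n).
Hypothesis y_inv : y \in involutions n.
Let s := fixed_points y.

Lemma involutionK i : y (y i) = i.
Proof.
by move: y_inv; rewrite inE expgS expg1 => /eqP y2; rewrite -permM y2 perm1.
Qed.

Lemma mem_fixed_points (i : 'I_n) : (val i \in s) = (y i == i).
Proof. by rewrite (mem_map val_inj) mem_filter mem_enum andbT. Qed.

Lemma fixed_points_uniq : uniq s.
Proof. by rewrite (map_inj_uniq val_inj) filter_uniq ?enum_uniq. Qed.

Lemma FPF_fixed (i : 'I_n) : y i = i -> FPF y i = (n + index (val i) s)%N.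
Proof. by move=> e; rewrite /FPF valK e eqxx. Qed.

Lemma FPF_moved (i : 'I_n) : y i != i -> FPF y i = y i.
Proof. by move=> /negbTE e; rewrite /FPF valK e. Qed.

Lemma FPF_mid l : (l < size s)%N -> FPF y (n + l) = nth 0%N s l.
Proof. by move=> ls; rewrite /FPF insubN -?leqNgt ?leq_addr // ltn_add2l ls addKn. Qed.

Lemma FPF_tail l :
  FPF y (n + size s + l) = if odd l then (n + size s + l).-1 else (n + size s + l).+1.
Proof.
rewrite /FPF insubN -?leqNgt; last by rewrite -addnA leq_addr.
by rewrite ltnNge leq_addr /= addKn.
Qed.

Lemma nth_fixed_points l : (l < size s)%N ->
  exists2 i : 'I_n, nth 0%N s l = i & y i = i.
Proof.
move=> ls; have := mem_nth 0%N ls => /mapP[i].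
by rewrite mem_filter => /andP[/eqP yi _] e; exists i.
Qed.

Lemma FPF_cases (m : nat) : (exists2 i : 'I_n, m = i :> nat & y i = i) \/
  (exists2 i : 'I_n, m = i :> nat & y i != i) \/
  (exists2 l, m = (n + l)%N & (l < size s)%N) \/
  (exists l, m = (n + size s + l)%N).
Proof.
case: (ltnP m n) => mn.
  by case: (eqVneq (y (Ordinal mn)) (Ordinal mn)) => h; [left|right; left]; exists (Ordinal mn).
right; right; case: (ltnP (m - n) (size s)) => ms; [left|right].
  by exists (m - n)%N; rewrite // subnKC.
by exists (m - n - size s)%N; rewrite -addnA !subnKC.
Qed.

Lemma FPF_neq m : FPF y m != m.
Proof.
case: (FPF_cases m) => [[i -> e]|[[i -> e]|[[l -> ls]|[l ->]]]].
- by rewrite FPF_fixed // gtn_eqF // (leq_trans (ltn_ord i)) ?leq_addr.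
- by rewrite FPF_moved.
- rewrite FPF_mid //; have [i -> _] := nth_fixed_points ls.
  by rewrite ltn_eqF // (leq_trans (ltn_ord i)) ?leq_addr.
rewrite FPF_tail; case: ifP => ol; last by rewrite gtn_eqF.
by rewrite ltn_eqF // ltn_predL addn_gt0 orbC; case: l ol.
Qed.

Lemma FPFK : involutive (FPF y).
Proof.
move=> m; case: (FPF_cases m) => [[i -> e]|[[i -> e]|[[l -> ls]|[l ->]]]].
- have iS : val i \in s by rewrite mem_fixed_points e.
  by rewrite (FPF_fixed e) FPF_mid ?index_mem // nth_index.
- rewrite (FPF_moved e) FPF_moved ?involutionK //.
  by rewrite eq_sym.
- rewrite (FPF_mid ls); have [i ei yi] := nth_fixed_points ls.
  by rewrite ei FPF_fixed // -[val i]ei index_uniq // fixed_points_uniq.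
rewrite FPF_tail; case: ifP => ol.
  case: l ol => // l /= ol; rewrite addnS /= FPF_tail.
  by rewrite -[odd l]negbK ol.
by rewrite -addnS FPF_tail /= ol /= addnS.
Qed.

End FPFInvolution.

(** * The cycle of inclusions *)

Section Inclusions.

Variables (K : closedFieldType) (n : nat) (z : nat -> nat).
Implicit Types (f g : ssring K n) (I : ssring K n -> Prop).

Lemma init_ideal_mono I I' f : (forall g, I g -> I' g) ->
  init_ideal I f -> init_ideal I' f.
Proof.
move=> II' [s [sI ->]]; exists s; split=> // c /sI[g Ig gc].
by exists g => //; apply: II'.
Qed.

Lemma J_ss_sub_init f : J_ss z f -> init_ideal (I_ss z) f.
Proof.
move=> Jf; exists [seq (f@_m, 'X_[m]) | m <- msupp f]; split.
  move=> c /mapP[m mf ->] /=; have [g Ig lg] := J_ss_lead Jf mf.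
  by exists g => //; apply: lead_init.
by rewrite big_map -mpolyE.
Qed.

Lemma init_sub_J_ss f : involutive z -> (forall a, z a != a) ->
  init_ideal (vanishing_ideal (@X_ss K n z)) f -> J_ss z f.
Proof.
move=> zK zf [s [sI ->]].
elim: s sI => [|c s IH] sI; first by rewrite big_nil; apply: ideal_gen0.
rewrite big_cons; apply: ideal_genD; last first.
  by apply: IH => c' cs; apply: sI; rewrite inE cs orbT.
have [g vg gc] := sI c (mem_head _ _); rewrite -mul_mpolyC; apply: ideal_genM.
case: gc => [[_ ->]|[m [mg mmax ->]]]; first exact: ideal_gen0.
apply: bad_mon_J_ss => //; apply: (@lead_bad K n z g) => //.
  by move=> b lb; apply: vg; apply: orb_X_ss.
by split=> //; rewrite -mcoeff_msupp.
Qed.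

End Inclusions.

Theorem theorem4p3 (K : closedFieldType) (n : nat) (hn : (0 < n)%N)
    (z : nat -> nat)
    (hz : exists2 y : 'S_n, y \in involutions n & forall m, z m = FPF y m) :
  (forall f : ssring K n, J_ss z f <-> init_ideal (I_ss z) f) /\
  (forall f : ssring K n,
     init_ideal (I_ss z) f <->
     init_ideal (vanishing_ideal (@X_ss K n z)) f).
Proof.
have [y yI zE] := hz.
have zK : involutive z by move=> a; rewrite !zE FPFK.
have zf a : z a != a by rewrite zE FPF_neq.
have IX f : init_ideal (I_ss z) f -> init_ideal (vanishing_ideal (@X_ss K n z)) f.
  by apply: init_ideal_mono => g; apply: I_ss_vanishes.
have XJ f : init_ideal (vanishing_ideal (@X_ss K n z)) f -> J_ss z f.
  exact: init_sub_J_ss.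
have JI f : J_ss z f -> init_ideal (I_ss z) f by apply: J_ss_sub_init.
by split=> f; split; auto.
Qed.
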